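(* Let $H\in(0,1]$ and let $G:\mathbb{R}\to\mathbb{R}$ be a bounded measurable function. Then \[ E\,G(\zeta_H)=\int_{-\infty}^{\infty} E\big[G(\zeta_H-t)\,q_t\big]\,dt . \]
   Context: Let $W^H=\{W^H_s,\ s\in\mathbb{R}\}$ be a two-sided fractional Brownian motion with Hurst parameter $H\in(0,1]$: a centered Gaussian process with continuous trajectories, $W^H_0=0$, and $E|W^H_s-W^H_t|^2=|s-t|^{2H}$ for all $s,t\in\mathbb{R}$. Define $Z_t=\exp\{W^H_t-\tfrac12|t|^{2H}\}$, $q_t=Z_t\left(\int_{-\infty}^{\infty}Z_u\,du\right)^{-1}$ for $t\in\mathbb{R}$, and $\zeta_H=\int_{-\infty}^{\infty} t\,q_t\,dt$. *)

(* Defs.v *)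
From HB Require Import structures.
From mathcomp Require Import all_boot all_order all_algebra.
From mathcomp Require Import all_classical all_reals all_analysis.
Set Implicit Arguments. Unset Strict Implicit. Unset Printing Implicit Defensive.
Import Order.TTheory GRing.Theory Num.Theory.
Import numFieldNormedType.Exports.
Local Open Scope classical_set_scope.
Local Open Scope ring_scope.

Section fbm.
Context {R : realType} {d : measure_display} {T : measurableType d}.
Variable P : probability T R.

Definition centered_gaussian (X : T -> R) : Prop :=
  P [set w | X w != 0] = 0%E \/
  exists s : R, 0 < s /\
    forall A : set R, measurable A -> P (X @^-1` A) = normal_prob 0 s A.

Definition centered_gaussian_process (W : R -> T -> R) : Prop :=
  forall s : seq (R * R),
    centered_gaussian (fun w => \sum_(p <- s) p.2 * W p.1 w).

Definition two_sided_fBm (H : R) (W : R -> T -> R) : Prop :=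
  [/\ forall t, measurable_fun setT (W t),
      centered_gaussian_process W,
      forall w, continuous (fun t => W t w),
      forall w, W 0 w = 0 &
      forall s t, (\int[P]_w ((W s w - W t w) ^+ 2)%:E)%E
                  = (powR `|s - t| (2 * H))%:E ].
End fbm.

Section functionals.
Context {R : realType} {T : Type}.
Variables (H : R) (W : R -> T -> R).

Definition Zt (t : R) (w : T) : R := expR (W t w - powR `|t| (2 * H) / 2).

Definition totalZ (w : T) : R :=
  Rintegral (@lebesgue_measure R) setT (fun u => Zt u w).

Definition qt (t : R) (w : T) : R := Zt t w / totalZ w.

Definition zetaH (w : T) : R :=
  Rintegral (@lebesgue_measure R) setT (fun t => t * qt t w).
End functionals.

(* Main.v *)
Require Import Defs.
From HB Require Import structures.
From mathcomp Require Import all_boot all_order all_algebra.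
From mathcomp Require Import all_classical all_reals all_analysis.
From mathcomp Require Import measurable_realfun ring lra zify.
Set Implicit Arguments. Unset Strict Implicit. Unset Printing Implicit Defensive.
Import Order.TTheory GRing.Theory Num.Theory.
Import numFieldNormedType.Exports.
Local Open Scope classical_set_scope.
Local Open Scope ring_scope.

(** Write [Z = exp L]. The measure with density [Z_t] shifts [W] by its covariance with [W_t], and
    [W] has stationary increments; together, under [Z_t P] the path [v |-> L_(v+t) - L_t] has the
    law of [L] under [P]. Applied to the functional [G (zeta) e^(c (-t)) / int e^c] of the path [c],
    this gives [E (G (zeta - t) q_t) = E (G (zeta) q_(-t))], and integrating over [t] concludes since
    [int q_(-t) dt = 1].

    The equality of laws on path space is read off exponential moments. Since these are finite for
    all linear combinations of evaluations, dominated convergence turns equality of exponential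
    moments into equality of moments, then of means of [cos] and [sin]; the latter form an algebra
    whose bounded limits contain the indicators of orthants.

    One also needs [int (1 + |t|) Z_t dt < oo] almost surely, although [E Z_t = 1]. With
    [N = int Z_u^a du], the equality of laws gives [E (Z_t / N) = E (Z_(-t)^a / N)]; as [1 / N] is at
    most [int_0^1 Z_u^(-a) du], for small [a] the right-hand side decays like [exp (- c |t|^(2H))].
    Hence [E (int (1 + |t|) Z_t dt / N)] is finite. *)

(** * Elementary real analysis *)

Section real_lemmas.
Context {R : realType}.
Implicit Types x s : R.

Lemma expR_sub1_le x : expR x - 1 <= x * expR x.
Proof.
have := expR_ge1Dx (- x); rewrite -(ler_pM2r (expR_gt0 x)).
by rewrite -expRD addNr expR0; lra.
Qed.

Lemma normr_expR_sub1_le x : `|expR x - 1| <= `|x| * expR `|x|.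
Proof.
have [x0|x0] := leP 0 x.
  by rewrite !ger0_norm ?expR_sub1_le// subr_ge0 -expR0 ler_expR.
rewrite !ltr0_norm ?subr_lt0 -?expR0 ?ltr_expR//.
have := expR_ge1Dx x; have : 1 <= expR (- x) by rewrite -expR0 ler_expR oppr_ge0 ltW.
rewrite expR0; nra.
Qed.

Lemma cvg_divn x : x / n.+1%:R @[n --> \oo] --> (0 : R).
Proof. by rewrite -(mulr0 x); apply: cvgM; [exact: cvg_cst|exact: cvg_harmonic]. Qed.

(** A difference quotient of [expR] at 0, squeezed between [x] and [x * expR (x / n.+1%:R)]. It
    recovers a power of [X] as a limit of combinations of exponentials of multiples of [X]. *)
Lemma cvg_scaled_expR_sub1 x : n.+1%:R * (expR (x / n.+1%:R) - 1) @[n --> \oo] --> x.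
Proof.
apply: (@squeeze_cvgr _ _ _ _ (fun=> x) (fun n => x * expR (x / n.+1%:R))).
- apply: nearW => n; set N : R := n.+1%:R.
  have N0 : 0 < N by [].
  have -> : x = N * (x / N) by rewrite mulrC divfK// gt_eqF.
  rewrite [X in expR (X / _)]mulrC mulfK ?gt_eqF//.
  rewrite ler_pM2l// -mulrA ler_pM2l// expR_sub1_le andbT.
  by rewrite lerBrDl expR_ge1Dx.
- exact: cvg_cst.
- suff : x * expR (x / n.+1%:R) @[n --> \oo] --> x * expR 0 by rewrite expR0 mulr1.
  apply: cvgM; first exact: cvg_cst.
  by apply: continuous_cvg; [exact: continuous_expR|exact: cvg_divn].
Qed.

(** The bound is uniform in [n], as dominated convergence requires: the quotient is at most
    [|x| e^|x|], and [|x| <= e^|x|]. *)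
Lemma normr_scaled_expR_sub1_le x n :
  `|n.+1%:R * (expR (x / n.+1%:R) - 1)| <= expR (2 * `|x|).
Proof.
have N0 : (0 : R) < n.+1%:R by [].
rewrite normrM gtr0_norm//.
apply: (@le_trans _ _ (n.+1%:R * (`|x / n.+1%:R| * expR `|x / n.+1%:R|))).
  by rewrite ler_pM2l// normr_expR_sub1_le.
rewrite normrM normfV (gtr0_norm N0) mulrA [_ * (_ / _)]mulrC divfK ?gt_eqF//.
rewrite mulr_natl mulr2n expRD ler_pM// ?expR_ge0//.
  by apply: le_trans (expR_ge1Dx _); rewrite lerDr.
by rewrite ler_expR ler_piMr// invf_le1// ler1n.
Qed.

Lemma expR_norm_le (r x : R) : expR (r * `|x|) <= expR (r * x) + expR (- r * x).
Proof.
have [x0|x0] := leP 0 x; first by rewrite ger0_norm// lerDl expR_ge0.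
by rewrite ltr0_norm// mulrN -mulNr lerDr expR_ge0.
Qed.

Lemma series_exp_coeff_le x n : \sum_(0 <= k < n) `|x| ^+ k / k`!%:R <= expR `|x|.
Proof.
apply: (@nondecreasing_cvgn_le _ (series (exp_coeff `|x|))).
  by apply/nondecreasing_series => i _ _; exact: exp_coeff_ge0.
exact: is_cvg_series_exp_coeff.
Qed.

(** An odd cubic fixing -1, 0 and 1 and preserving [-1, 1]. Its iterates converge there to the sign
    of [s]. *)
Definition smoothstep s : R := (3 * s - s ^+ 3) / 2.

Lemma smoothstep_itv s : -1 <= s <= 1 -> -1 <= smoothstep s <= 1.
Proof.
move=> /andP[h1 h2]; rewrite /smoothstep.
(* The two products are twice [1 - smoothstep s] and twice [1 + smoothstep s]. *)
have a : (1 - s) ^+ 2 * (2 + s) >= 0 by rewrite mulr_ge0 ?sqr_ge0//; lra.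
have b : (1 + s) ^+ 2 * (2 - s) >= 0 by rewrite mulr_ge0 ?sqr_ge0//; lra.
by apply/andP; split; nra.
Qed.

Lemma iter_smoothstep_itv s m : -1 <= s <= 1 -> -1 <= iter m smoothstep s <= 1.
Proof. by move=> s1; elim: m => //= m ih; exact: smoothstep_itv. Qed.

Lemma iter_smoothstepN s m : iter m smoothstep (- s) = - iter m smoothstep s.
Proof. by elim: m => //= m ->; rewrite /smoothstep; field. Qed.

Lemma iter_smoothstep0 m : iter m smoothstep 0 = 0.
Proof. by elim: m => //= m ->; rewrite /smoothstep; field. Qed.

(** One step multiplies the gap [1 - u] by [1 - (u + u ^+ 2) / 2], which is at most [1 - s / 2] as
    long as [u >= s]. The first conjunct keeps this lower bound along the induction. *)
Lemma iter_smoothstep_ge s m : 0 < s <= 1 ->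
  s <= iter m smoothstep s /\ 1 - iter m smoothstep s <= (1 - s / 2) ^+ m.
Proof.
move=> /andP[s0 s1]; elim: m => [|m [ih1 ih2]] /=; first by rewrite expr0; split; lra.
have /andP[_ u1] : -1 <= iter m smoothstep s <= 1.
  by apply: iter_smoothstep_itv; lra.
set u := iter m smoothstep s in ih1 ih2 u1 *; rewrite /smoothstep.
have u2 : u ^+ 2 <= 1 by nra.
split; first by rewrite exprS; nra.
have -> : 1 - (3 * u - u ^+ 3) / 2 = (1 - u) * (1 - (u + u ^+ 2) / 2) by field.
rewrite [leRHS]exprSr ler_pM//; [lra|nra|nra].
Qed.

Lemma cvg_iter_smoothstep s : 0 < s <= 1 -> iter m smoothstep s @[m --> \oo] --> (1 : R).
Proof.
move=> s1; apply: (@squeeze_cvgr _ _ _ _ (fun m => 1 - (1 - s / 2) ^+ m) (fun=> 1)).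
- apply: nearW => m; have [_ h] := iter_smoothstep_ge m s1.
  have /andP[_ ->] : -1 <= iter m smoothstep s <= 1 by apply: iter_smoothstep_itv; lra.
  by rewrite andbT; lra.
- rewrite -[X in _ --> X]subr0; apply: cvgB; first exact: cvg_cst.
  by apply: cvg_expr; rewrite ger0_norm; lra.
- exact: cvg_cst.
Qed.

(* Polynomials in [s] converging boundedly on [-1, 1] to the indicator of [s > 0]. *)
Definition step_poly m s : R := (iter m smoothstep s + iter m smoothstep s ^+ 2) / 2.

Lemma normr_step_poly_le m s : -1 <= s <= 1 -> `|step_poly m s| <= 1.
Proof.
move=> /(iter_smoothstep_itv m); rewrite /step_poly.
by set u := iter _ _ _ => /andP[h1 h2]; rewrite ler_norml; apply/andP; split; nra.
Qed.

Lemma cvg_step_poly s : -1 <= s <= 1 -> step_poly m s @[m --> \oo] --> ((0 < s)%R%:R : R).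
Proof.
move=> /andP[h1 h2]; rewrite /step_poly.
have aux (l : R) : iter m smoothstep s @[m --> \oo] --> l ->
    (iter m smoothstep s + iter m smoothstep s ^+ 2) / 2 @[m --> \oo] --> (l + l ^+ 2) / 2.
  move=> hl; apply: cvgMr_tmp; apply: cvgD => //.
  by under eq_fun do rewrite expr2; rewrite expr2; exact: cvgM.
have [s0|s0|s0] := ltgtP 0 s.
- have -> : true%:R = (1 + 1 ^+ 2) / 2 :> R by rewrite expr1n divff.
  by apply: aux; apply: cvg_iter_smoothstep; rewrite s0.
- have -> : false%:R = (-1 + (-1) ^+ 2) / 2 :> R by rewrite sqrrN expr1n addNr mul0r.
  apply: aux; rewrite -(opprK s); under eq_fun do rewrite iter_smoothstepN.
  by apply: cvgN; apply: cvg_iter_smoothstep; lra.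
- have -> : false%:R = (0 + 0 ^+ 2) / 2 :> R by rewrite expr0n addr0 mul0r.
  apply: aux; rewrite -s0; under eq_fun do rewrite iter_smoothstep0; exact: cvg_cst.
Qed.

End real_lemmas.

(** * Measures with the same exponential moments *)

Section equal_integrals.
Context d (E : measurableType d) (R : realType).
Variables mu nu : {measure set E -> \bar R}.
Implicit Types f g X : E -> R.

Definition eqint f : Prop :=
  [/\ mu.-integrable setT (EFin \o f), nu.-integrable setT (EFin \o f) &
      (\int[mu]_x (f x)%:E = \int[nu]_x (f x)%:E)%E].

Lemma eqint_measurable {f} : eqint f -> measurable_fun setT f.
Proof. by move=> [/measurable_int/measurable_EFinP]. Qed.

Lemma eqint_lin a b f g : eqint f -> eqint g -> eqint (fun x => a * f x + b * g x).
Proof.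
have lin (m : {measure set E -> \bar R}) : m.-integrable setT (EFin \o f) ->
    m.-integrable setT (EFin \o g) ->
    m.-integrable setT (EFin \o (fun x => a * f x + b * g x)) /\
    (\int[m]_x (a * f x + b * g x)%:E =
     a%:E * \int[m]_x (f x)%:E + b%:E * \int[m]_x (g x)%:E)%E.
  move=> mf mg; have mf' := integrableZl measurableT a mf.
  have mg' := integrableZl measurableT b mg; split.
    exact: (integrableD measurableT mf' mg').
  by rewrite -integralZl// -integralZl// -integralD.
move=> [mf nf fE] [mg ng gE]; have [mi mE] := lin _ mf mg.
by have [ni nE] := lin _ nf ng; split => //; rewrite mE nE fE gE.
Qed.

(** Dominated convergence under both measures at once. Every passage to a larger class of functions
    below goes through this closure property. *)
Lemma eqint_cvg (h : nat -> E -> R) f g :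
  mu.-integrable setT (EFin \o g) -> nu.-integrable setT (EFin \o g) ->
  (forall n, eqint (h n)) -> (forall n x, `|h n x| <= g x) ->
  (forall x, h n x @[n --> \oo] --> f x) -> eqint f.
Proof.
move=> mg ng eh hg hf.
have mf : measurable_fun setT f.
  by apply: measurable_fun_cvg (fun x _ => hf x) => n; exact: eqint_measurable.
have dct (m : {measure set E -> \bar R}) : m.-integrable setT (EFin \o g) ->
    m.-integrable setT (EFin \o f) /\
    (\int[m]_x (h n x)%:E)%E @[n --> \oo] --> (\int[m]_x (f x)%:E)%E.
  move=> ig; have [] := @dominated_convergence _ _ _ m _ measurableT
    (fun n => EFin \o h n) (EFin \o f) (EFin \o g) _ _ _ ig.
  - by move=> n; apply/measurable_EFinP; exact: eqint_measurable.
  - exact/measurable_EFinP.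
  - by apply: aeW => x _; apply: cvg_EFin; [exact: nearW|exact: hf].
  - by apply: aeW => x n _; rewrite lee_fin.
  - by move=> ? _ ?; split.
have [mif mcv] := dct mu mg; have [nif ncv] := dct nu ng; split => //.
rewrite -(cvg_lim (@ereal_hausdorff R) mcv) -(cvg_lim (@ereal_hausdorff R) ncv).
by congr (lim (_ @ \oo)); apply/funext => n; case: (eh n).
Qed.

End equal_integrals.

Section exponential_moments.
Context d (E : measurableType d) (R : realType).
Variables mu nu : {measure set E -> \bar R}.
Variable X : E -> R.
Hypothesis eX : forall r, eqint mu nu (fun x => expR (r * X x)).

Lemma eqint_exp_sum r : eqint mu nu (fun x => expR (r * X x) + expR (- r * X x)).
Proof.
by have := eqint_lin 1 1 (eX r) (eX (- r)); under eq_fun do rewrite !mul1r.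
Qed.

Lemma eqint_exp_sub1X (n k : nat) :
  eqint mu nu (fun x => (n.+1%:R * (expR (X x / n.+1%:R) - 1)) ^+ k).
Proof.
pose Y x := expR (X x / n.+1%:R).
(* The factor [Y x ^+ j] makes the induction on [k] close: multiplying by [Y x - 1] gives a
   difference of two instances, at [j.+1] and at [j]. *)
suff H j : eqint mu nu (fun x => Y x ^+ j * (n.+1%:R * (Y x - 1)) ^+ k).
  by have := H 0%N; under eq_fun do rewrite expr0 mul1r.
elim: k j => [|k ih] j.
  have := eX (j%:R / n.+1%:R); congr eqint; apply/funext => x.
  by rewrite expr0 mulr1 /Y -expRM_natl; congr expR; field.
have := eqint_lin n.+1%:R (- n.+1%:R) (ih j.+1) (ih j); congr eqint.
by apply/funext => x; rewrite !exprS; ring.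
Qed.

Lemma eqint_X k : eqint mu nu (fun x => X x ^+ k).
Proof.
have [mg ng _] := eqint_exp_sum (k%:R * 2).
apply: (eqint_cvg mg ng (fun n => eqint_exp_sub1X n k)) => [n x|x].
  apply: le_trans (expR_norm_le _ _).
  rewrite normrX -mulrA expRM_natl.
  by apply: lerXn2r; rewrite ?nnegrE ?expR_ge0//; exact: normr_scaled_expR_sub1_le.
have := @cvg_scaled_expR_sub1 R (X x); elim: k {mg ng} => [|k ih] h.
  by under eq_fun do rewrite expr0; exact: cvg_cst.
by under eq_fun do rewrite exprS; rewrite exprS; apply: cvgM => //; exact: ih.
Qed.

Lemma eqint_poly (c : nat -> R) n :
  eqint mu nu (fun x => \sum_(0 <= k < n) c k * X x ^+ k).
Proof.
elim: n => [|n ih].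
  have := eqint_lin 0 0 (eX 0) (eX 0); congr eqint; apply/funext => x.
  by rewrite big_nil !mul0r addr0.
have := eqint_lin 1 (c n) ih (eqint_X n); congr eqint; apply/funext => x.
by rewrite big_nat_recr//= mul1r.
Qed.

(** With coefficients bounded by those of the exponential series, all partial sums are dominated by
    [e^|X|], hence by the integrable [e^X + e^(-X)]. *)
Lemma eqint_entire (c : nat -> R) (f : R -> R) :
  (forall k, `|c k| <= k`!%:R^-1) ->
  (forall x, series (fun k => c k * x ^+ k) @ \oo --> f x) ->
  eqint mu nu (fun x => f (X x)).
Proof.
move=> cle cf; have [mg ng _] := eqint_exp_sum 1.
apply: (eqint_cvg mg ng (eqint_poly c)) => [n x|x]; last exact: cf.
apply: le_trans (expR_norm_le _ _); rewrite mul1r.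
apply: le_trans (series_exp_coeff_le _ n).
apply: le_trans (ler_norm_sum _ _ _) _.
apply: ler_sum => k _; rewrite normrM normrX mulrC.
by rewrite ler_wpM2l// exprn_ge0.
Qed.

Lemma eqint_cos : eqint mu nu (fun x => cos (X x)).
Proof.
apply: (@eqint_entire (fun n => (~~ odd n)%:R * (-1) ^+ n./2 * (n`!%:R)^-1)).
  move=> k; rewrite !normrM normfV normrX normrN1 expr1n mulr1 !normr_nat.
  by case: (odd k); rewrite ?mul0r ?mul1r// invr_ge0.
by move=> x; rewrite cosE -cos_coeffE; exact: is_cvg_series_cos_coeff.
Qed.

Lemma eqint_sin : eqint mu nu (fun x => sin (X x)).
Proof.
apply: (@eqint_entire (fun n => (odd n)%:R * (-1) ^+ n.-1./2 * (n`!%:R)^-1)).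
  move=> k; rewrite !normrM normfV normrX normrN1 expr1n mulr1 !normr_nat.
  by case: (odd k); rewrite ?mul0r ?mul1r// invr_ge0.
by move=> x; rewrite sinE /pseries -sin_coeffE; exact: is_cvg_series_sin_coeff.
Qed.

Lemma eqint_cos_phase phi : eqint mu nu (fun x => cos (X x + phi)).
Proof.
have := eqint_lin (cos phi) (- sin phi) eqint_cos eqint_sin; congr eqint.
by apply/funext => x; rewrite cosD; ring.
Qed.

End exponential_moments.

(** Encoding by lists of strict lower bounds makes intersection a concatenation and the whole space
    the empty list, so orthants form a pi-system. *)
Definition orthant (R : realType) (E I : Type) (V : I -> E -> R) (s : seq (I * R)) : set E :=
  [set x | all (fun p => p.2 < V p.1 x) s].

(** * From exponential moments to trigonometric functions, orthants and the whole measure *)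

Section exponential_moments_determine_measure.
Context d (E : measurableType d) (R : realType).
Variables mu nu : {measure set E -> \bar R}.
Variable L : set (E -> R).
Hypothesis L_lin : forall a b X Y, L X -> L Y -> L (fun x => a * X x + b * Y x).
Hypothesis eL : forall X, L X -> eqint mu nu (fun x => expR (X x)).

Lemma scale_closed r X : L X -> L (fun x => r * X x).
Proof.
by move=> LX; have := L_lin r 0 LX LX; under eq_fun do rewrite mul0r addr0.
Qed.

Lemma eqint_exp_scale X : L X -> forall r, eqint mu nu (fun x => expR (r * X x)).
Proof. by move=> LX r; exact: (eL (scale_closed r LX)). Qed.

(** Trigonometric polynomials in the members of [L]. Cosines with a phase suffice: a sine is a
    cosine with phase shifted by [- pi / 2]. *)
Inductive trig : (E -> R) -> Prop :=
| trig_cos X phi : L X -> trig (fun x => cos (X x + phi))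
| trig_lin a b f g : trig f -> trig g -> trig (fun x => a * f x + b * g x).

Lemma trig_bounded f : trig f -> exists M, forall x, `|f x| <= M.
Proof.
elim=> [X phi _|a b g h _ [M gM] _ [N hN]].
  by exists 1 => x; rewrite ler_norml cos_geN1 cos_le1.
exists (`|a| * M + `|b| * N) => x; rewrite (le_trans (ler_normD _ _))// !normrM.
by rewrite lerD// ler_wpM2l.
Qed.

Lemma eqint_trig f : trig f -> eqint mu nu f.
Proof.
elim=> [X phi LX|a b g h _ eg _ eh]; last exact: eqint_lin.
exact/eqint_cos_phase/eqint_exp_scale.
Qed.

(** The product-to-sum formula for two cosines, extended bilinearly; it uses that [L] contains sums
    and differences. *)
Lemma trig_mul f g : trig f -> trig g -> trig (fun x => f x * g x).
Proof.
move=> tf; elim: tf g => [X phi LX|a b f1 f2 _ ih1 _ ih2] g tg; last first.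
  have := trig_lin a b (ih1 _ tg) (ih2 _ tg); congr trig.
  by apply/funext => x; ring.
elim: tg => [Y psi LY|a b g1 g2 _ ih1 _ ih2]; last first.
  by have := trig_lin a b ih1 ih2; congr trig; apply/funext => x; ring.
have := trig_lin 2^-1 2^-1 (trig_cos (phi + psi) (L_lin 1 1 LX LY))
  (trig_cos (phi - psi) (L_lin 1 (- 1) LX LY)).
congr trig; apply/funext => x.
have -> : 1 * X x + 1 * Y x + (phi + psi) = (X x + phi) + (Y x + psi) by ring.
have -> : 1 * X x + - 1 * Y x + (phi - psi) = (X x + phi) - (Y x + psi) by ring.
by rewrite cosB cosD; field.
Qed.

Lemma trig_step_poly m f : trig f -> trig (fun x => step_poly m (f x)).
Proof.
move=> tf; have tm : trig (fun x => iter m smoothstep (f x)).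
  elim: m => //= m ih; have := trig_lin (3 / 2) (- 2^-1) ih (trig_mul ih (trig_mul ih ih)).
  by congr trig; apply/funext => x; rewrite /smoothstep; field.
have := trig_lin 2^-1 2^-1 tm (trig_mul tm tm); congr trig.
by apply/funext => x; rewrite /step_poly; field.
Qed.

Lemma trig_sin X (c r : R) : L X -> trig (fun x => sin ((X x - c) / r)).
Proof.
move=> LX; have := trig_cos (- c / r - pi / 2) (scale_closed r^-1 LX); congr trig.
by apply/funext => x; rewrite addrA cosBpihalf; congr sin; ring.
Qed.

Hypothesis L0 : L !=set0.

Lemma integrable_cst_L (c : R) :
  mu.-integrable setT (EFin \o (fun=> c)) /\ nu.-integrable setT (EFin \o (fun=> c)).
Proof.
have [X LX] := L0; have [+ + _] := eqint_lin c 0 (eqint_exp_scale LX 0) (eqint_exp_scale LX 0).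
by under eq_fun do rewrite !mul0r expR0 mulr1 addr0.
Qed.

(** Once [|y| / n.+1 < pi], the sine has the sign of its argument. The threshold depends on [y],
    which is enough for pointwise convergence. *)
Lemma sin_scale_sign (y : R) : \forall n \near \oo, (0 < sin (y / n.+1%:R)) = (0 < y).
Proof.
have : y / n.+1%:R @[n --> \oo] --> (0 : R) by exact: cvg_divn.
move/cvgrPdist_lt => /(_ pi (pi_gt0 _)) h; near=> n.
have : `|0 - y / n.+1%:R| < pi by near: n; exact: h.
have N0 : (0 : R) < n.+1%:R^-1 by rewrite invr_gt0.
rewrite sub0r normrN; have [y0|y0|<-] := ltgtP 0 y.
- by rewrite gtr0_norm ?mulr_gt0// => yp; rewrite sin_gt0_pi// mulr_gt0.
- have z0 : 0 < - y / n.+1%:R by rewrite mulr_gt0 ?oppr_gt0.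
  rewrite -normrN -mulNr gtr0_norm// => yp; apply/negbTE; rewrite -leNgt.
  by rewrite -oppr_ge0 -sinN -mulNr ltW// sin_gt0_pi// z0.
- by rewrite mul0r sin0 ltxx.
Unshelve. all: by end_near. Qed.

Variables (I : Type) (V : I -> E -> R).
Hypothesis LV : forall i, L (V i).

(** Half-spaces are added one at a time. The factor [f] is arbitrary so that the approximation of
    the next indicator, itself in [trig], can be absorbed into it. *)
Lemma eqint_trig_orthant (s : seq (I * R)) f : trig f ->
  eqint mu nu (fun x => f x * (all (fun p => p.2 < V p.1 x) s)%:R).
Proof.
elim: s f => [|[i c] s ih] f tf /=.
  by under eq_fun do rewrite mulr1; exact: eqint_trig.
have [M fM] := trig_bounded tf; have [mM nM] := integrable_cst_L M.
have sin_itv (y : R) : -1 <= sin y <= 1 by rewrite sin_geN1 sin_le1.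
pose B x : R := (all (fun p => p.2 < V p.1 x) s)%:R.
have B1 x : `|B x| <= 1 by rewrite /B; case: all; rewrite ?normr0 ?normr1.
(* Limit in [m]: the step polynomials of a sine tend to the indicator that the sine is positive. The
   limit in [n] afterwards turns this into the indicator of [c < V i x]. *)
have step n : eqint mu nu (fun x => f x * (0 < sin ((V i x - c) / n.+1%:R))%R%:R * B x).
  apply: (eqint_cvg mM nM
    (fun m => ih _ (trig_mul tf (trig_step_poly m (trig_sin c n.+1%:R (LV i)))))) => [m x|x].
    rewrite -mulrA normrM -[leRHS]mulr1 ler_pM// normrM -[leRHS]mulr1 ler_pM//.
    - exact: normr_step_poly_le.
    - exact: B1.
  apply: cvgM; [apply: cvgM|]; [exact: cvg_cst| |exact: cvg_cst].
  exact: cvg_step_poly.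
apply: (eqint_cvg mM nM step) => [n x|x].
  rewrite -mulrA normrM -[leRHS]mulr1 ler_pM// normrM -[leRHS]mulr1 ler_pM//.
  by case: (0 < sin _); rewrite ?normr0 ?normr1.
apply: cvg_near_cst; have := sin_scale_sign (V i x - c); apply: filterS => n ->.
by rewrite subr_gt0 /B; case: (c < _) => /=; rewrite ?mulr1// mulr0 mul0r.
Qed.

Lemma exp_moments_unique (dE : d.-measurable = <<s range (orthant V) >>) (A : set E) :
  measurable A -> mu A = nu A.
Proof.
apply: (measure_unique (range (orthant V)) (fun=> orthant V [::])) => //.
- move=> _ _ [s _ <-] [t _ <-]; exists (s ++ t) => //.
  apply/seteqP; split=> x; rewrite /orthant /= all_cat; first by move/andP.
  by move=> [-> ->].
- by apply/seteqP; split => // x _; exists 0%N.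
- move=> _ [s _ <-]; have [X LX] := L0.
  have mO : measurable (orthant V s).
    by rewrite dE; apply: sub_sigma_algebra; exists s.
  (* The cosine of the zero multiple of [X] is the constant 1, which leaves the measure of the
     orthant. *)
  have := eqint_trig_orthant s (trig_cos 0 (scale_closed 0 LX)); case=> _ _.
  under eq_integral do rewrite mul0r addr0 cos0 mul1r.
  under [RHS]eq_integral do rewrite mul0r addr0 cos0 mul1r.
  have indicE (m : {measure set E -> \bar R}) :
      (\int[m]_x (all (fun p => p.2 < V p.1 x) s)%:R%:E)%E = m (orthant V s).
    rewrite -[in RHS](setIT (orthant V s)) -integral_indic//; apply: eq_integral => x _.
    by rewrite indicE /orthant mem_setE.
  by rewrite !indicE.
- move=> _; have -> : orthant V [::] = setT by apply/seteqP; split.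
  have [/integrableP[_] + _] := integrable_cst_L 1.
  under eq_integral do rewrite /= normr1.
  by rewrite integral_cst// mul1e.
Qed.

End exponential_moments_determine_measure.

(** * Measurability on the space of continuous paths *)

Section path_space.
Variable R : realType.

Definition cont_path := {c : R -> R | continuous c}.

HB.instance Definition _ := gen_eqMixin cont_path.
HB.instance Definition _ := gen_choiceMixin cont_path.

Lemma continuous_fun0 : continuous (fun _ : R => (0 : R)).
Proof. by move=> x; exact: cvg_cst. Qed.

HB.instance Definition _ := isPointed.Build cont_path (exist _ _ continuous_fun0).

Definition eval (t : R) (c : cont_path) : R := sval c t.

(** The sigma-algebra generated by the evaluations, presented by orthants to match the hypothesis
    [dE] of [exp_moments_unique]. *)
Definition cpath := g_sigma_algebraType (range (orthant eval)).
HB.instance Definition _ := Measurable.on cpath.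

Lemma measurable_eval t : measurable_fun [set: cpath] (eval t).
Proof.
move=> mD; apply: (measurability _ (RGenOInfty.measurableE R)) => //.
move=> _ [_ [x ->] <-]; apply: sub_sigma_algebra; exists [:: (t, x)] => //.
by apply/seteqP; split => c /=; rewrite /orthant/= in_itv/= !andbT => // -[].
Qed.

Lemma measurable_to_cpath d (T : measurableType d) (f : R -> T -> R)
    (cf : forall w, continuous (f ^~ w)) :
  (forall t, measurable_fun setT (f t)) ->
  measurable_fun setT (fun w => exist _ _ (cf w) : cpath).
Proof.
move=> mf mT; apply: (@measurability _ _ T cpath setT _ (range (orthant eval))) => //.
move=> _ [_ [s _ <-] <-]; rewrite setTI; elim: s => [|[t x] s ih].
  by rewrite (_ : _ @^-1` _ = setT)//; apply/seteqP; split.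
rewrite (_ : _ @^-1` _ = f t @^-1` `]x, +oo[ `&`
  (fun w => exist _ _ (cf w) : cpath) @^-1` orthant eval s).
  by apply: measurableI => //; rewrite -[X in measurable X]setTI; exact: mf.
apply/seteqP; split => w; rewrite /orthant/= in_itv/= andbT; first by move=> /andP.
by move=> [? ?]; apply/andP.
Qed.

End path_space.

(** * Joint measurability in time and sample point *)

Section joint_measurability.
Context d (T : measurableType d) (R : realType).

Lemma cvg_floor_approx (t : R) :
  (Num.floor (n.+1%:R * t))%:~R / n.+1%:R @[n --> \oo] --> t.
Proof.
apply: (@squeeze_cvgr _ _ _ _ (fun n => t - 1 / n.+1%:R) (fun=> t)).
- apply: nearW => n; have N0 : (0 : R) < n.+1%:R by [].
  have /andP[h1 h2] := floor_itv (n.+1%:R * t).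
  rewrite intrD in h2.
  rewrite ler_pdivrMr// [t * _]mulrC h1 andbT ler_pdivlMr//.
  by rewrite mulrBl divfK ?gt_eqF// [t * _]mulrC lerBlDr ltW.
- rewrite -[X in _ --> X]subr0; apply: cvgB; [exact: cvg_cst|exact: cvg_divn].
- exact: cvg_cst.
Qed.

(** Rounding time down to the grid of step [1 / n.+1] gives a function that is constant in time on
    each of countably many strips, hence measurable; continuity in time gives the limit. *)
Lemma measurable_joint (f : R -> T -> R) :
  (forall t, measurable_fun setT (f t)) -> (forall w, continuous (f ^~ w)) ->
  measurable_fun setT (fun p : R * T => f p.1 p.2).
Proof.
move=> mf cf; pose q n (t : R) : R := (Num.floor (n.+1%:R * t))%:~R / n.+1%:R.
apply: (@measurable_fun_cvg _ _ _ _ (fun n p => f (q n p.1) p.2)); last first.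
  move=> [t w] _; apply: (@cvg_comp _ _ _ _ (f ^~ w)); first exact: cvg_floor_approx.
  exact: cf.
move=> n _ B mB; rewrite setTI.
rewrite (_ : _ @^-1` _ = \bigcup_(k : int)
    (`[k%:~R / n.+1%:R, (k + 1)%:~R / n.+1%:R[%classic `*` (f (k%:~R / n.+1%:R) @^-1` B))).
  apply: countable_bigcupT_measurable; first exact: countableP.
  move=> k; apply: measurableX => //.
  by rewrite -[X in measurable X]setTI; exact: mf.
have N0 : (0 : R) < n.+1%:R by [].
apply/seteqP; split => [[t w] /= Bf|[t w] [k _] [/=]].
  exists (Num.floor (n.+1%:R * t)) => //; split => //=.
  have /andP[h1 h2] := floor_itv (n.+1%:R * t).
  by rewrite in_itv/= ler_pdivrMr// ltr_pdivlMr// [t * _]mulrC h1 h2.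
rewrite in_itv/= ler_pdivrMr// ltr_pdivlMr// [t * _]mulrC => h.
by rewrite /q (floor_def h).
Qed.

End joint_measurability.

(** * Densities and invariance of Lebesgue measure *)

Section density.
Context d (T : measurableType d) (R : realType).
Local Open Scope ereal_scope.
Variables (mu nu : {measure set T -> \bar R}) (g : T -> R).
Hypotheses (mg : measurable_fun setT g) (g0 : forall x, (0 <= g x)%R).
Hypothesis nuE : forall A, measurable A -> nu A = \int[mu]_(x in A) (g x)%:E.

Import HBNNSimple.

(** For indicators this is [nuE]; simple functions follow by linearity, and [f] by monotone
    convergence along its simple approximations. *)
Lemma ge0_integral_density (f : T -> \bar R) :
  measurable_fun setT f -> (forall x, 0 <= f x) ->
  \int[nu]_x f x = \int[mu]_x (f x * (g x)%:E).
Proof.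
move=> mf f0; pose h := nnsfun_approx measurableT mf.
have fE x : f x = limn (EFin \o h ^~ x).
  by apply/esym/cvg_lim => //; exact: cvg_nnsfun_approx.
have mh n r : measurable_fun setT (fun x => (r * \1_(h n @^-1` [set r]) x)%:E).
  by apply/measurable_EFinP/measurable_funM.
transitivity (limn (fun n => \int[nu]_x (h n x)%:E)).
  under eq_integral do rewrite fE; apply: monotone_convergence => //.
  - by move=> n; exact/measurable_EFinP.
  - by move=> n x _; rewrite lee_fin.
  - by move=> x _ a b ab; rewrite lee_fin; exact/lefP/nd_nnsfun_approx.
transitivity (limn (fun n => \int[mu]_x ((h n x)%:E * (g x)%:E))); last first.
  rewrite -monotone_convergence//.
  - apply: eq_integral => x _; apply/cvg_lim => //; apply: cvgeZr => //.
    exact: cvg_nnsfun_approx.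
  - move=> n; apply: emeasurable_funM; first exact/measurable_EFinP/measurable_funP.
    exact/measurable_EFinP.
  - by move=> n x _; rewrite mule_ge0 ?lee_fin.
  - move=> x _ a b ab; rewrite lee_wpmul2r ?lee_fin//.
    exact/lefP/nd_nnsfun_approx.
congr (limn _); apply/funext => n.
under eq_integral do rewrite fimfunE -fsumEFin//.
rewrite (ge0_integral_fsum nu measurableT (mh n))//; last first.
  by move=> r x _; exact: nnfun_muleindic_ge0.
under [RHS]eq_integral do rewrite fimfunE -fsumEFin//.
under [RHS]eq_integral.
  move=> x _; rewrite ge0_mule_fsuml; last by move=> r; exact: nnfun_muleindic_ge0.
  over.
rewrite ge0_integral_fsum//; last 2 first.
  - by move=> r; apply: emeasurable_funM; [exact: mh|exact/measurable_EFinP].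
  - by move=> r x _; apply: mule_ge0; [exact: nnfun_muleindic_ge0|rewrite lee_fin].
apply: eq_fsbigr => r rh.
rewrite integralZl_indic_nnsfun// integral_indic// setIT nuE//.
under [RHS]eq_integral do rewrite EFinM -muleA.
rewrite ge0_integralZl//.
- congr (_ * _); rewrite integral_mkcond; apply: eq_integral => x _.
  by rewrite epatch_indic muleC.
- by apply: emeasurable_funM; exact/measurable_EFinP.
- by move=> x _; rewrite mule_ge0 ?lee_fin.
- by move: rh; rewrite inE => -[x _ <-]; rewrite lee_fin.
Qed.

End density.

Section density_measure.
Context d (T : measurableType d) (R : realType).
Local Open Scope ereal_scope.
Variables (mu : {measure set T -> \bar R}) (g : T -> R).
Hypotheses (mg : measurable_fun setT g) (g0 : forall x, (0 <= g x)%R).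

(** The proofs are arguments of the definition so that the measure structure declared below attaches
    to the resulting term. *)
Definition density_measure (_ : measurable_fun setT g) (_ : forall x, (0 <= g x)%R)
  (A : set T) : \bar R := \int[mu]_(x in A) (g x)%:E.

Let dens := density_measure mg g0.

Let dens0 : dens set0 = 0. Proof. exact: integral_set0. Qed.

Let dens_ge0 A : 0 <= dens A.
Proof. by apply: integral_ge0 => x _; rewrite lee_fin. Qed.

Let dens_sigma_additive : semi_sigma_additive dens.
Proof.
apply: semi_sigma_additive_nng_induced; first exact/measurable_EFinP.
by move=> x; rewrite lee_fin.
Qed.

HB.instance Definition _ :=
  isMeasure.Build _ _ _ (density_measure mg g0) dens0 dens_ge0 dens_sigma_additive.

End density_measure.

(** * Invariance of Lebesgue measure under translation and reflection *)

Section lebesgue_invariance.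
Context {R : realType}.
Local Notation mu := (@lebesgue_measure R).
Local Open Scope ereal_scope.

(** The image of Lebesgue measure under the translation agrees with it on half-open intervals, hence
    on all measurable sets. *)
Lemma ge0_integral_shift (f : R -> \bar R) (a : R) :
  measurable_fun setT f -> (forall x, 0 <= f x) ->
  \int[mu]_x f (x + a)%R = \int[mu]_x f x.
Proof.
move=> mf f0; pose S (x : measurableTypeR R) : measurableTypeR R := (x + a)%R.
have ms : measurable_fun setT S.
  exact: measurable_funD.
transitivity (\int[pushforward mu S]_x f x).
  by rewrite ge0_integral_pushforward// preimage_setT.
apply: eq_measure_integral => A mA _; apply/esym.
apply: lebesgue_measure_unique => //.
move=> X /ocitvP[->|[[u v] /= uv ->]]; first by rewrite !measure0.
rewrite /pushforward (_ : _ @^-1` _ = `](u - a)%R, (v - a)%R]%classic); last first.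
  by apply/seteqP; split => x /=; rewrite !in_itv/= ltrBlDr lerBrDr.
rewrite !lebesgue_measure_itv/= !lte_fin uv ltrD2r uv.
by rewrite -!EFinD; congr EFin; ring.
Qed.

Lemma ge0_integral_opp (f : R -> \bar R) :
  measurable_fun setT f -> (forall x, 0 <= f x) ->
  \int[mu]_x f (- x)%R = \int[mu]_x f x.
Proof.
move=> mf f0; pose S (x : measurableTypeR R) : measurableTypeR R := (- x)%R.
have ms : measurable_fun setT S.
  exact: oppr_measurable.
transitivity (\int[pushforward mu S]_x f x).
  by rewrite ge0_integral_pushforward// preimage_setT.
apply: eq_measure_integral => A mA _; apply/esym.
apply: lebesgue_measure_unique => //.
move=> X /ocitvP[->|[[u v] /= uv ->]]; first by rewrite !measure0.
(* Reflection swaps the open and the closed end, which does not change the length. *)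
rewrite /pushforward (_ : _ @^-1` _ = `[(- v)%R, (- u)%R[%classic); last first.
  by apply/seteqP; split => x /=; rewrite !in_itv/= ltrNr lerNl andbC.
rewrite !lebesgue_measure_itv/= !lte_fin uv ltrN2 uv.
by rewrite -!EFinD; congr EFin; ring.
Qed.

Lemma integral_shift (f : R -> R) (a : R) : measurable_fun setT f ->
  (\int[mu]_x (f (x + a)%R)%:E = \int[mu]_x (f x)%:E)%E.
Proof.
move=> mf; have mfe : measurable_fun setT (EFin \o f) by exact/measurable_EFinP.
rewrite integralE [RHS]integralE; congr (_ - _)%E.
- by rewrite -(ge0_integral_shift a (measurable_funepos mfe) (funepos_ge0 _));
    apply: eq_integral => x _; rewrite !funeposE.
- by rewrite -(ge0_integral_shift a (measurable_funeneg mfe) (funeneg_ge0 _));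
    apply: eq_integral => x _; rewrite !funenegE.
Qed.

End lebesgue_invariance.

(** * Gaussian exponential moments *)

Section moments.
Context d (T : measurableType d) (R : realType) (P : probability T R).
Implicit Types (f g X : T -> R) (m : R).

Definition has_mean f m :=
  P.-integrable setT (EFin \o f) /\ (\int[P]_w (f w)%:E = m%:E)%E.

Lemma has_mean_lin a b f g m n : has_mean f m -> has_mean g n ->
  has_mean (fun w => a * f w + b * g w) (a * m + b * n).
Proof.
move=> [fi fm] [gi gn]; have fi' := integrableZl measurableT a fi.
have gi' := integrableZl measurableT b gi; split.
  exact: (integrableD measurableT fi' gi').
transitivity (\int[P]_w (a%:E * (f w)%:E + b%:E * (g w)%:E))%E => //.
by rewrite integralD// integralZl// integralZl// fm gn.
Qed.

Lemma has_mean_scale a f m : has_mean f m -> has_mean (fun w => a * f w) (a * m).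
Proof.
move=> fm; have := has_mean_lin a 0 fm fm; rewrite mul0r addr0.
by congr has_mean; apply/funext => w; rewrite mul0r addr0.
Qed.

Lemma has_mean_cst c : has_mean (fun=> c) c.
Proof.
split; first exact: finite_measure_integrable_cst.
by rewrite integral_cst// -[RHS]mule1; congr (_ * _)%E; exact: probability_setT.
Qed.

Lemma has_mean_sum (I : Type) (s : seq I) (F : I -> T -> R) (m : I -> R) :
  (forall i, has_mean (F i) (m i)) ->
  has_mean (fun w => \sum_(i <- s) F i w) (\sum_(i <- s) m i).
Proof.
move=> Fm; elim: s => [|i s ih].
  by rewrite big_nil; under eq_fun do rewrite big_nil; exact: has_mean_cst.
rewrite big_cons; have := has_mean_lin 1 1 (Fm i) ih; rewrite !mul1r.
by congr has_mean; apply/funext => w; rewrite big_cons !mul1r.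
Qed.

Lemma has_mean_unique f m n : has_mean f m -> has_mean f n -> m = n.
Proof. by move=> [_ fm] [_]; rewrite fm => -[]. Qed.

Lemma has_mean_ge0 f m : measurable_fun setT f -> (forall w, 0 <= f w) ->
  (\int[P]_w (f w)%:E = m%:E)%E -> has_mean f m.
Proof.
move=> mf f0 fm; split => //; apply/integrableP; split; first exact/measurable_EFinP.
by under eq_integral do rewrite /= ger0_norm//; rewrite fm ltry.
Qed.

(** The second moment is the limit of the means of [(N (e^(X/N) - 1))^2]. These are explicit, [N^2
    (e^(2v/N^2) - 1) - 2 N^2 (e^(v/(2N^2)) - 1)], and tend to [2v - v]. *)
Lemma has_mean_sqr X v : (forall r, has_mean (fun w => expR (r * X w)) (expR (r ^+ 2 * v / 2))) ->
  has_mean (fun w => X w ^+ 2) v.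
Proof.
move=> eX; pose h n w := (n.+1%:R * (expR (X w / n.+1%:R) - 1)) ^+ 2.
have eX' r : eqint P P (fun w => expR (r * X w)) by have [] := eX r.
have [X2i _ _] := eqint_X eX' 2; split => //.
have hm n : has_mean (h n) (n.+1%:R ^+ 2 * (expR ((2 * v) / n.+1%:R ^+ 2) - 1)
    - 2 * (n.+1%:R ^+ 2 * (expR ((v / 2) / n.+1%:R ^+ 2) - 1))).
  have := has_mean_lin (n.+1%:R ^+ 2) 1 (eX (2 / n.+1%:R))
    (has_mean_lin (- 2 * n.+1%:R ^+ 2) (n.+1%:R ^+ 2) (eX n.+1%:R^-1) (has_mean_cst 1)).
  rewrite (_ : (2 / n.+1%:R) ^+ 2 * v / 2 = (2 * v) / n.+1%:R ^+ 2); last first.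
    by field; rewrite nat1r.
  rewrite (_ : (n.+1%:R^-1) ^+ 2 * v / 2 = (v / 2) / n.+1%:R ^+ 2); last first.
    by field; rewrite nat1r.
  have e2 w : expR (2 / n.+1%:R * X w) = expR (X w / n.+1%:R) ^+ 2.
    by rewrite -expRM_natl; congr expR; ring.
  congr has_mean; last by ring.
  apply/funext => w; rewrite e2 [n.+1%:R^-1 * _]mulrC /h; ring.
have hcv : (\int[P]_w (h n w)%:E)%E @[n --> \oo] --> (\int[P]_w (X w ^+ 2)%:E)%E.
  have [gi _ _] := eqint_exp_sum eX' (2%:R * 2).
  have [] := @dominated_convergence _ _ _ P _ measurableT
    (fun n => EFin \o h n) (EFin \o (fun w => X w ^+ 2)) _ _ _ _ gi.
  - by move=> n; case: (hm n) => /measurable_int.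
  - by move/measurable_int : X2i.
  - apply: aeW => w _; apply: cvg_EFin; first exact: nearW.
    suff : h n w @[n --> \oo] --> X w ^+ 2 by [].
    rewrite expr2 /h; under eq_fun do rewrite expr2.
    by apply: cvgM; exact: cvg_scaled_expR_sub1.
  - apply: aeW => w n _; rewrite lee_fin; apply: le_trans (expR_norm_le _ _).
    rewrite normrX -mulrA expRM_natl.
    by apply: lerXn2r; rewrite ?nnegrE ?expR_ge0//; exact: normr_scaled_expR_sub1_le.
  - by [].
(* The limit of [N^2 (e^(u/N^2) - 1)] is that of [cvg_scaled_expR_sub1] along squares; the
   predecessor compensates the successor in that lemma. *)
have sq : (n.+1 ^ 2)%N.-1 @[n --> \oo] --> \oo.
  apply/cvgnyPge => A; exists A => // n /= An.
  by rewrite (leq_trans An)//; lia.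
have lcv (u : R) : n.+1%:R ^+ 2 * (expR (u / n.+1%:R ^+ 2) - 1) @[n --> \oo] --> u.
  have := cvg_comp _ _ sq (@cvg_scaled_expR_sub1 R u).
  rewrite /comp; under eq_fun do rewrite prednK ?expn_gt0// natrX.
  by [].
have vcv : (\int[P]_w (h n w)%:E)%E @[n --> \oo] --> v%:E.
  under eq_fun do rewrite (hm _).2.
  apply: cvg_EFin; first exact: nearW.
  rewrite [X in _ --> X](_ : v = 2 * v - 2 * (v / 2)); last by field.
  apply: cvgB; first exact: lcv.
  by apply: cvgM; [exact: cvg_cst|exact: lcv].
by rewrite -(cvg_lim (@ereal_hausdorff R) vcv) -(cvg_lim (@ereal_hausdorff R) hcv).
Qed.


Lemma integral_normal_exp (s r : R) : 0 < s ->
  (\int[normal_prob 0 s]_x (expR (r * x))%:E = (expR (r ^+ 2 * s ^+ 2 / 2))%:E)%E.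
Proof.
move=> s0; have sN0 : s != 0 by rewrite gt_eqF.
have me : measurable_fun setT (fun x : R => expR (r * x)).
  by apply: measurableT_comp => //; exact: measurable_funM.
rewrite (@ge0_integral_density _ _ _ lebesgue_measure (normal_prob 0 s) _
  (measurable_normal_pdf 0 s) (normal_pdf_ge0 0 s) (fun _ _ => erefl)); last 2 first.
- exact/measurable_EFinP.
- by move=> x; rewrite lee_fin expR_ge0.
(* Completing the square: tilting the centered density by [e^(r x)] gives, up to a constant, the
   normal density with mean [r * s ^+ 2]. *)
transitivity (\int[@lebesgue_measure R]_x
    ((expR (r ^+ 2 * s ^+ 2 / 2))%:E * (normal_pdf (r * s ^+ 2) s x)%:E))%E.
  apply: eq_integral => x _; rewrite -!EFinM /normal_pdf (negbTE sN0) /normal_fun.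
  rewrite mulrCA [in RHS]mulrCA -!expRD; congr (_ * expR _)%:E.
  by field.
rewrite ge0_integralZl ?integral_normal_pdf ?mule1//.
- by apply/measurable_EFinP; exact: measurable_normal_pdf.
- by move=> x _; rewrite lee_fin normal_pdf_ge0.
Qed.

Lemma centered_gaussian_mgf X : measurable_fun setT X -> centered_gaussian P X ->
  exists v, forall r, has_mean (fun w => expR (r * X w)) (expR (r ^+ 2 * v / 2)).
Proof.
move=> mX [X0|[s [s0 Xs]]].
  exists 0 => r; apply: has_mean_ge0 => [|w|].
  - by apply: measurableT_comp => //; exact: measurable_funM.
  - exact: expR_ge0.
  - rewrite mulr0 mul0r expR0 -(has_mean_cst 1).2; apply: ae_eq_integral => //.
      by apply/measurable_EFinP; apply: measurableT_comp => //; exact: measurable_funM.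
    exists [set w | X w != 0]; split => //.
      rewrite (_ : mkset _ = X @^-1` (~` [set 0])).
        by rewrite -[X in measurable X]setTI; apply: mX => //; exact: measurableC.
      by apply/seteqP; split => w /= /eqP.
    move=> w /= h; apply/eqP => X0'; apply: h => _.
    by rewrite X0' mulr0 expR0.
exists (s ^+ 2) => r; apply: has_mean_ge0 => [|w|].
- by apply: measurableT_comp => //; exact: measurable_funM.
- exact: expR_ge0.
rewrite -integral_normal_exp//.
transitivity (\int[pushforward P (X : T -> measurableTypeR R)]_x (expR (r * x))%:E)%E.
  rewrite ge0_integral_pushforward//.
  by apply/measurable_EFinP; apply: measurableT_comp => //; exact: measurable_funM.
by apply: eq_measure_integral => A mA _; exact: Xs.
Qed.

(** Gaussianity yields the exponential moments with some variance [u]; [has_mean_sqr] identifies [u]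
    with the second moment. *)
Lemma centered_gaussian_exp X v : measurable_fun setT X -> centered_gaussian P X ->
  has_mean (fun w => X w ^+ 2) v -> has_mean (fun w => expR (X w)) (expR (v / 2)).
Proof.
move=> mX gX X2; have [u eX] := centered_gaussian_mgf mX gX.
rewrite (has_mean_unique X2 (has_mean_sqr eX)); have := eX 1.
by under eq_fun do rewrite mul1r; rewrite expr1n mul1r.
Qed.

End moments.

(** * Exponential moments of linear combinations of fractional Brownian motion *)

Section fBm_exponential_moments.
Context (R : realType) d (T : measurableType d) (P : probability T R).
Variables (H : R) (W : R -> T -> R).
Hypothesis H0 : 0 < H.
Hypothesis fW : two_sided_fBm P H W.

Let k (t : R) : R := `|t| `^ (2 * H).

(** Polarization: the product is half of [W_s^2 + W_t^2 - (W_s - W_t)^2], and [W_0 = 0] makes each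
    square that of an increment. *)
Lemma fBm_cov s t : has_mean P (fun w => W s w * W t w) ((k s + k t - k (s - t)) / 2).
Proof.
have [mW _ _ W0 EW] := fW.
have inc u v : has_mean P (fun w => (W u w - W v w) ^+ 2) (k (u - v)).
  apply: has_mean_ge0 => [|w|]; [|exact: sqr_ge0|exact: EW].
  by apply: measurable_funX; exact: measurable_funB.
have sqr u : has_mean P (fun w => W u w ^+ 2) (k u).
  by have := inc u 0; rewrite subr0; under eq_fun do rewrite W0 subr0.
have := has_mean_lin 2^-1 1 (sqr s) (has_mean_lin 2^-1 (- 2^-1) (sqr t) (inc s t)).
by congr has_mean; [apply/funext => w; field|field].
Qed.

Definition fBm_lin (s : seq (R * R)) (w : T) := \sum_(p <- s) p.2 * W p.1 w.

(** The quadratic form of the covariance at the weights [p.2]. The terms [k s] and [k t] of the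
    covariance merge into the product of sums. *)
Definition fBm_var (s : seq (R * R)) : R :=
  (\sum_(p <- s) p.2) * (\sum_(p <- s) p.2 * k p.1) -
  (\sum_(p <- s) \sum_(q <- s) p.2 * q.2 * k (p.1 - q.1)) / 2.

Lemma fBm_lin_sqr s : has_mean P (fun w => fBm_lin s w ^+ 2) (fBm_var s).
Proof.
have := has_mean_sum s (fun p => has_mean_sum s (fun q =>
  has_mean_scale (p.2 * q.2) (fBm_cov p.1 q.1))).
congr has_mean.
  apply/funext => w; rewrite expr2 /fBm_lin big_distrlr/=.
  by apply: eq_bigr => p _; apply: eq_bigr => q _; ring.
have -> : \sum_(p <- s) \sum_(q <- s) p.2 * q.2 * ((k p.1 + k q.1 - k (p.1 - q.1)) / 2) =
  \sum_(p <- s) \sum_(q <- s) ((p.2 * k p.1) * q.2 / 2 + p.2 * (q.2 * k q.1) / 2 +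
    - (p.2 * q.2 * k (p.1 - q.1)) / 2).
  by apply: eq_bigr => p _; apply: eq_bigr => q _; ring.
under eq_bigr do rewrite !big_split/= -!mulr_suml sumrN -!mulr_sumr.
rewrite !big_split/= -!mulr_suml sumrN /fBm_var; by field.
Qed.

Lemma fBm_lin_exp s c :
  has_mean P (fun w => expR (fBm_lin s w + c)) (expR (fBm_var s / 2 + c)).
Proof.
have [mW gW _ _ _] := fW.
have mL : measurable_fun setT (fBm_lin s).
  by apply: measurable_sum => p; exact: measurable_funM.
have := has_mean_scale (expR c) (centered_gaussian_exp mL (gW s) (fBm_lin_sqr s)).
by congr has_mean; [apply/funext => w|]; rewrite -expRD addrC.
Qed.

(** The computation behind the change of law: the recentred combination weighted by [Z_t] has the
    same log-mean as the original one. Adding [W_t] to the increments [W_(p+t) - W_t] leaves it with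
    weight [1 - sg]. *)
Lemma fBm_shift_var t (a : seq (R * R)) (sg := \sum_(p <- a) p.2) :
  fBm_var ((t, 1 - sg) :: [seq (p.1 + t, p.2) | p <- a]) / 2
  - k t / 2 - \sum_(p <- a) p.2 * ((k (p.1 + t) - k t) / 2) =
  fBm_var a / 2 - \sum_(p <- a) p.2 * (k p.1 / 2).
Proof.
have k0 : k 0 = 0 by rewrite /k normr0 powR0// mulf_neq0// gt_eqF.
have kN u : k (- u) = k u by rewrite /k normrN.
set s := _ :: _; set S0 := \sum_(p <- a) p.2 * k p.1.
(* Total weight 1 makes the first term of [fBm_var] linear in [k t] and the [k (p.1 + t)], and it
   cancels against the drift. The double sum only sees time differences, so the shift by [t]
   disappears from it. *)
have sg1 : \sum_(p <- s) p.2 = 1 by rewrite big_cons big_map /= subrK.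
have U1 : \sum_(p <- s) p.2 * k p.1 = (1 - sg) * k t + \sum_(p <- a) p.2 * k (p.1 + t).
  by rewrite big_cons big_map.
have DD : \sum_(p <- s) \sum_(q <- s) p.2 * q.2 * k (p.1 - q.1) =
    2 * (1 - sg) * S0 + \sum_(p <- a) \sum_(q <- a) p.2 * q.2 * k (p.1 - q.1).
  rewrite big_cons big_map big_cons big_map /= subrr k0 mulr0 add0r.
  rewrite (eq_bigr (fun p => (1 - sg) * (p.2 * k p.1))); last first.
    move=> p _; rewrite [p.1 + t]addrC opprD addrA subrr sub0r kN; ring.
  rewrite -mulr_sumr -/S0.
  rewrite (eq_bigr (fun p => (1 - sg) * (p.2 * k p.1) +
      \sum_(q <- a) p.2 * q.2 * k (p.1 - q.1))); last first.
    move=> p _; rewrite big_cons big_map /= addrK; congr (_ + _); first by ring.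
    by apply: eq_bigr => q _; rewrite opprD addrACA subrr addr0.
  by rewrite big_split/= -mulr_sumr -/S0; ring.
rewrite /fBm_var sg1 U1 DD -/sg -/S0.
have -> : \sum_(p <- a) p.2 * (k p.1 / 2) = S0 / 2.
  by rewrite mulr_suml; apply: eq_bigr => p _; rewrite mulrA.
have -> : \sum_(p <- a) p.2 * ((k (p.1 + t) - k t) / 2) =
    (\sum_(p <- a) p.2 * k (p.1 + t)) / 2 - sg * k t / 2.
  rewrite /sg !mulr_suml -sumrB; apply: eq_bigr => p _; ring.
by field.
Qed.

End fBm_exponential_moments.

(** * Change of law *)

Lemma continuous_powR_norm (R : realType) (p : R) : 0 < p ->
  continuous (fun t : R => `|t| `^ p).
Proof.
move=> p0 t; have [->|t0] := eqVneq t 0.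
  apply/cvgrPdist_lt => e e0; rewrite normr0 powR0 ?gt_eqF//.
  near=> s; rewrite sub0r normrN ger0_norm ?powR_ge0//.
  have -> : e = (e `^ p^-1) `^ p by rewrite -powRrM mulVf ?gt_eqF// powRr1// ltW.
  apply: gt0_ltr_powR => //; rewrite ?nnegrE ?powR_ge0//.
  near: s; exists (e `^ p^-1); first exact: powR_gt0.
  by move=> x /=; rewrite sub0r normrN.
apply: (@continuous_comp _ _ _ (fun t : R => `|t|) (fun x : R => x `^ p)).
  exact: norm_continuous.
apply/differentiable_continuous/derivable1_diffP; apply: derivable_powR.
by rewrite in_itv/= andbT normr_gt0.
Unshelve. all: by end_near. Qed.

Lemma continuous_shift_arg (R : realType) (f : R -> R) a : continuous f ->
  continuous (fun x => f (x + a)).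
Proof.
move=> cf x; apply: (@continuous_comp _ _ _ (fun x : R => x + a) f); last exact: cf.
by apply: cvgD; [exact: cvg_id|exact: cvg_cst].
Qed.

Section change_of_law.
Context (R : realType) d (T : measurableType d) (P : probability T R).
Variables (H : R) (W : R -> T -> R).
Hypothesis H0 : 0 < H.
Hypothesis fW : two_sided_fBm P H W.

Definition logZ (t : R) (w : T) : R := W t w - `|t| `^ (2 * H) / 2.

Lemma ZtE t w : Zt H W t w = expR (logZ t w). Proof. by []. Qed.

Lemma measurable_logZ t : measurable_fun setT (logZ t).
Proof. by have [mW _ _ _ _] := fW; apply: measurable_funB. Qed.

Lemma measurable_Zt t : measurable_fun setT (Zt H W t).
Proof. by apply: measurableT_comp => //; exact: measurable_logZ. Qed.

Lemma Zt_ge0 t w : 0 <= Zt H W t w. Proof. exact: expR_ge0. Qed.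

Lemma continuous_logZ w : continuous (logZ ^~ w).
Proof.
have [_ _ cW _ _] := fW; move=> t; apply: cvgB; first exact: cW.
apply: cvgM; last exact: cvg_cst.
by apply: continuous_powR_norm; rewrite mulr_gt0.
Qed.

Definition inclogZ t v w := logZ (v + t) w - logZ t w.

Lemma measurable_inclogZ t v : measurable_fun setT (inclogZ t v).
Proof. by apply: measurable_funB; exact: measurable_logZ. Qed.

Lemma continuous_inclogZ t w : continuous (fun v => inclogZ t v w).
Proof.
move=> v; apply: cvgB; last exact: cvg_cst.
exact: (continuous_shift_arg (@continuous_logZ w)).
Qed.

Definition path_logZ w : cpath R := exist _ _ (@continuous_logZ w).
Definition path_inclogZ t w : cpath R := exist _ _ (@continuous_inclogZ t w).

Lemma measurable_path_logZ : measurable_fun setT path_logZ.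
Proof. by apply: measurable_to_cpath => t; exact: measurable_logZ. Qed.

Lemma measurable_path_inclogZ t : measurable_fun setT (path_inclogZ t).
Proof. by apply: measurable_to_cpath => v; exact: measurable_inclogZ. Qed.

Definition eval_lin (a : seq (R * R)) (c : cpath R) : R :=
  \sum_(p <- a) p.2 * eval p.1 c.

Lemma measurable_eval_lin a : measurable_fun setT (eval_lin a).
Proof. by apply: measurable_sum => p; apply: measurable_funM => //; exact: measurable_eval. Qed.

Lemma exp_lin_logZ a : has_mean P (fun w => expR (eval_lin a (path_logZ w)))
  (expR (fBm_var H a / 2 - \sum_(p <- a) p.2 * (`|p.1| `^ (2 * H) / 2))).
Proof.
have := fBm_lin_exp fW a (- \sum_(p <- a) p.2 * (`|p.1| `^ (2 * H) / 2)).
congr has_mean; apply/funext => w; congr expR.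
rewrite /fBm_lin -sumrB; apply: eq_bigr => p _.
by rewrite -mulrBr.
Qed.

(** The exponent is a linear form in [W] plus a constant, so its mean is explicit, and
    [fBm_shift_var] removes every trace of [t] from it. *)
Lemma exp_lin_inclogZ t a :
  has_mean P (fun w => expR (eval_lin a (path_inclogZ t w)) * Zt H W t w)
  (expR (fBm_var H a / 2 - \sum_(p <- a) p.2 * (`|p.1| `^ (2 * H) / 2))).
Proof.
rewrite -(fBm_shift_var H0 t a) -addrA.
have := fBm_lin_exp fW ((t, 1 - \sum_(p <- a) p.2) :: [seq (p.1 + t, p.2) | p <- a])
  (- (`|t| `^ (2 * H) / 2) - \sum_(p <- a) p.2 * ((`|p.1 + t| `^ (2 * H) - `|t| `^ (2 * H)) / 2)).
congr has_mean; apply/funext => w; rewrite -expRD; congr expR.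
rewrite /fBm_lin big_cons big_map /= /eval_lin /=.
have -> : \sum_(p <- a) p.2 * inclogZ t p.1 w =
  \sum_(p <- a) p.2 * W (p.1 + t) w - (\sum_(p <- a) p.2) * W t w -
  \sum_(p <- a) p.2 * ((`|p.1 + t| `^ (2 * H) - `|t| `^ (2 * H)) / 2).
  rewrite mulr_suml -!sumrB; apply: eq_bigr => p _.
  by rewrite /inclogZ /logZ; field.
by rewrite /logZ; ring.
Qed.

(* Cameron-Martin shift by the covariance with [W_t], combined with the stationarity of the
   increments of [W]. *)
Lemma change_of_law t (Phi : cpath R -> \bar R) :
  measurable_fun setT Phi -> (forall c, 0 <= Phi c)%E ->
  (\int[P]_w (Phi (path_inclogZ t w) * (Zt H W t w)%:E) = \int[P]_w Phi (path_logZ w))%E.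
Proof.
move=> mPhi Phi0; set Q := density_measure P (measurable_Zt t) (Zt_ge0 t).
have [mu1 mu1E] : exists m : {measure set (cpath R) -> \bar R},
    forall A, m A = Q (path_inclogZ t @^-1` A).
  by unshelve eexists; [refine (pushforward Q (path_inclogZ t)); exact: measurable_path_inclogZ|].
have [mu2 mu2E] : exists m : {measure set (cpath R) -> \bar R},
    forall A, m A = P (path_logZ @^-1` A).
  by unshelve eexists; [refine (pushforward P path_logZ); exact: measurable_path_logZ|].
have int1 (f : cpath R -> \bar R) : measurable_fun setT f -> (forall c, 0 <= f c)%E ->
    (\int[mu1]_c f c = \int[P]_w (f (path_inclogZ t w) * (Zt H W t w)%:E))%E.
  move=> mf f0; transitivity (\int[Q]_w f (path_inclogZ t w))%E.
    rewrite -[RHS](@ge0_integral_pushforward _ _ _ _ _ _ (measurable_path_inclogZ t) Q setT f)//.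
    apply: eq_measure_integral => [|? A mA _]; [exact: measurable_path_inclogZ|exact: mu1E].
  apply: ge0_integral_density => //; first exact: measurable_Zt.
  - exact: Zt_ge0.
  - exact: measurableT_comp (measurable_path_inclogZ t).
have int2 (f : cpath R -> \bar R) : measurable_fun setT f -> (forall c, 0 <= f c)%E ->
    (\int[mu2]_c f c = \int[P]_w f (path_logZ w))%E.
  move=> mf f0.
  rewrite -[RHS](@ge0_integral_pushforward _ _ _ _ _ _ measurable_path_logZ P setT f)//.
  apply: eq_measure_integral => [|? A mA _]; [exact: measurable_path_logZ|exact: mu2E].
rewrite -int1// -int2//; apply: eq_measure_integral => A mA _.
have mexp a : measurable_fun setT (fun c => expR (eval_lin a c)).
  by apply: measurableT_comp => //; exact: measurable_eval_lin.
(* Linear forms in evaluations are stable under linear combinations and contain the evaluations, and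
   both laws give them the same explicit exponential moment. *)
apply: (@exp_moments_unique _ _ _ mu1 mu2 (range eval_lin) _ _ _ _ (@eval R)) => //.
- move=> a b _ _ [s _ <-] [u _ <-].
  exists ([seq (p.1, a * p.2) | p <- s] ++ [seq (p.1, b * p.2) | p <- u]) => //.
  apply/funext => c; rewrite /eval_lin big_cat !big_map/= !mulr_sumr.
  by congr (_ + _); apply: eq_bigr => p _; rewrite mulrA.
- move=> _ [a _ <-].
  have me : measurable_fun setT (fun c => (expR (eval_lin a c))%:E) by exact/measurable_EFinP.
  have e0 c : (0 <= (expR (eval_lin a c))%:E)%E by rewrite lee_fin expR_ge0.
  have m1 : (\int[mu1]_c (expR (eval_lin a c))%:E = (expR (fBm_var H a / 2 -
      \sum_(p <- a) p.2 * (`|p.1| `^ (2 * H) / 2)))%:E)%E.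
    by rewrite (int1 _ me e0) -(exp_lin_inclogZ t a).2.
  have m2 : (\int[mu2]_c (expR (eval_lin a c))%:E = (expR (fBm_var H a / 2 -
      \sum_(p <- a) p.2 * (`|p.1| `^ (2 * H) / 2)))%:E)%E.
    by rewrite (int2 _ me e0) -(exp_lin_logZ a).2.
  split; last by rewrite m1 m2.
  + apply/integrableP; split; first exact/measurable_EFinP.
    by under eq_integral do rewrite /= ger0_norm ?expR_ge0//; rewrite m1 ltry.
  + apply/integrableP; split; first exact/measurable_EFinP.
    by under eq_integral do rewrite /= ger0_norm ?expR_ge0//; rewrite m2 ltry.
- by exists (eval_lin [::]), [::].
- move=> t'; exists [:: (t', 1)] => //; apply/funext => c.
  by rewrite /eval_lin big_seq1 mul1r.
Qed.

End change_of_law.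

(** * Almost sure integrability of [(1 + |t|) Z_t] *)

Section lebesgue_integrals.
Context {R : realType}.
Local Notation mu := (@lebesgue_measure R).

Lemma measurable_funV_ge0 d (T : measurableType d) (f : T -> R) :
  measurable_fun setT f -> (forall x, 0 <= f x) -> measurable_fun setT (fun x => (f x)^-1).
Proof.
move=> mf f0; under eq_fun do rewrite -powR_inv1//.
exact: (measurableT_comp (measurable_powR (-1)) mf).
Qed.

(** Infinite [x] is covered as well, since [fine] then makes both sides 0. *)
Lemma fine_mul_gt0 (x : \bar R) (r : R) : 0 < r -> fine (x * r%:E) = fine x * r.
Proof.
move=> r0; case: x => [x| |] //=; rewrite mul0r.
- by rewrite mulyr gtr0_sg// mul1e.
- by rewrite mulNyr gtr0_sg// mul1e.
Qed.

(** A zero integral would force [f = 0] almost everywhere, so the whole line would be negligible. *)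
Lemma lebesgue_integral_gt0 (f : R -> R) : measurable_fun setT f ->
  (forall x, 0 < f x) -> (0 < \int[mu]_x (f x)%:E)%E.
Proof.
move=> mf f0; rewrite lt0e integral_ge0 ?andbT; last first.
  by move=> x _; rewrite lee_fin ltW.
apply/eqP => int0.
have /ae_eq_integral_abs : (\int[mu]_x `|(f x)%:E| = 0)%E.
  by rewrite -int0; apply: eq_integral => x _; rewrite gee0_abs// lee_fin ltW.
move=> /(_ measurableT) [|N [mN N0 fN]]; first exact/measurable_EFinP.
have : mu N = +oo%E.
  rewrite (_ : N = setT).
    by rewrite -set_itvNyy lebesgue_measure_itv/=.
  apply/seteqP; split => // x _; apply: fN => /= /(_ Logic.I) -[] fx0.
  by have := f0 x; rewrite fx0 ltxx.
by rewrite N0.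
Qed.

Lemma expR_ge_expn (x : R) m : 0 <= x -> x ^+ m / m`!%:R <= expR x.
Proof.
move=> x0; have := series_exp_coeff_le x m.+1; rewrite ger0_norm//.
apply: le_trans; rewrite big_nat_recr//= lerDr sumr_ge0// => k _.
by rewrite divr_ge0// exprn_ge0.
Qed.

Lemma stretched_exp_decay (p b : R) : 0 < p -> 0 < b ->
  exists2 C : R, 0 <= C & forall t : R,
    (1 + `|t|) * expR (- (b * `|t| `^ p)) <= C * (oneDsqr t)^-1.
Proof.
(* With [p * m >= 3], the power [(x^p)^m] dominates [x^3] for [x > 1], and the order [m] term of the
   exponential series at [b x^p] bounds [e^(- b x^p) x^3] by [D]. In the constant, 4 serves
   [|t| <= 1] and [4 * D] the rest. *)
move=> p0 b0; pose m := (Num.trunc (3 / p)).+1.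
have m3 : 3 <= p * m%:R.
  by rewrite mulrC -ler_pdivrMr// ltW// /m truncnS_gt.
pose D : R := m`!%:R / b ^+ m; have D0 : 0 <= D by rewrite divr_ge0// exprn_ge0// ltW.
exists (4 + 4 * D) => [|t]; first by rewrite addr_ge0// mulr_ge0.
rewrite ler_pdivlMr ?(lt_le_trans ltr01 (oneDsqr_ge1 _))// /oneDsqr.
rewrite -[t ^+ 2]real_normK ?num_real//.
set x := `|t|; have x0 : 0 <= x by exact: normr_ge0.
have y0 : 0 <= x `^ p by exact: powR_ge0.
have e1 : expR (- (b * x `^ p)) <= 1.
  by rewrite -expR0 ler_expR oppr_le0 mulr_ge0// ltW.
have e0 := expR_ge0 (- (b * x `^ p)).
have [x1|x1] := leP x 1.
  have b1 : (1 + x) * (1 + x ^+ 2) <= 4 by nra.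
  rewrite mulrAC; apply: (@le_trans _ _ (4 * 1)); last by lra.
  by rewrite ler_pM// mulr_ge0// ?addr_ge0 ?sqr_ge0.
have x3 : x ^+ 3 <= (x `^ p) ^+ m.
  rewrite -powR_mulrn// -powRrM -[x ^+ 3]powR_mulrn//.
  by apply: ler_powR => //; exact: ltW.
have eD : expR (- (b * x `^ p)) * x ^+ 3 <= D.
  rewrite expRN mulrC ler_pdivrMr ?expR_gt0//.
  apply: (le_trans x3).
  have := expR_ge_expn m (mulr_ge0 (ltW b0) y0).
  rewrite ler_pdivrMr ?ltr0n ?fact_gt0// exprMn => h.
  by rewrite /D mulrAC ler_pdivlMr ?exprn_gt0// mulrC [_%:R * _]mulrC.
have b3 : (1 + x) * (1 + x ^+ 2) <= 4 * x ^+ 3 by rewrite exprSr; nra.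
rewrite mulrAC; apply: (@le_trans _ _ (4 * x ^+ 3 * expR (- (b * x `^ p)))); last by lra.
by rewrite ler_wpM2r.
Qed.

Lemma integral_decay_lty (p b : R) : 0 < p -> 0 < b ->
  (\int[mu]_t ((1 + `|t|) * expR (- (b * `|t| `^ p)))%:E < +oo)%E.
Proof.
move=> p0 b0; have [C C0 le] := stretched_exp_decay p0 b0.
have mD : measurable_fun setT (fun t : R => (oneDsqr t)^-1).
  by apply: continuous_measurable_fun; exact: continuous_oneDsqrV.
apply: (@le_lt_trans _ _ (\int[mu]_t (C * (oneDsqr t)^-1)%:E)%E).
  apply: ge0_le_integral => //.
  - apply/measurable_EFinP; apply: measurable_funM; first exact: measurable_funD.
    apply: measurableT_comp => //; apply: measurableT_comp => //.
    apply: measurable_funM => //.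
    exact: (measurableT_comp (measurable_powR p) (@normr_measurable R setT)).
  - by apply/measurable_EFinP; exact: measurable_funM.
  - by move=> t _; rewrite lee_fin.
under eq_integral do rewrite EFinM.
rewrite ge0_integralZl//; last exact/measurable_EFinP.
rewrite (@ge0_symfun_integralT _ (fun t : R => (oneDsqr t)^-1)).
- rewrite (_ : [set x : R | (0 <= x)%R] = `[0%R, +oo[%classic).
    by rewrite integral0y_oneDsqr -!EFinM ltry.
  by apply/seteqP; split => x /=; rewrite in_itv/= andbT.
- by move=> x; rewrite invr_ge0 (le_trans ler01)// oneDsqr_ge1.
- exact: continuous_oneDsqrV.
- by move=> x /=; rewrite /oneDsqr sqrrN.
Qed.

(* Jensen on [0, 1]. A divergent integral gives [fine +oo = 0], whose inverse is [0]. *)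
Lemma inv_integral_le (g : R -> R) : measurable_fun setT g -> (forall x, 0 < g x) ->
  (((fine (\int[mu]_x (g x)%:E))^-1)%:E <= \int[mu]_(x in `[0%R, 1%R]) ((g x)^-1)%:E)%E.
Proof.
move=> mg g0; set N := fine _.
have mgV : measurable_fun setT (fun x => (g x)^-1).
  by apply: measurable_funV_ge0 => // x; exact: ltW.
have J0 : (0 <= \int[mu]_(x in `[0%R, 1%R]) ((g x)^-1)%:E)%E.
  by apply: integral_ge0 => x _; rewrite lee_fin invr_ge0 ltW.
have N0 : 0 <= N by rewrite fine_ge0// integral_ge0// => x _; rewrite lee_fin ltW.
move: N0; rewrite le_eqVlt => /predU1P[<-|N0]; first by rewrite invr0.
have NE : (\int[mu]_x (g x)%:E = N%:E)%E.
  by move: N0; rewrite /N; case: (integral _ _ _) => [r| |] //=; rewrite ltxx.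
have h1 : (\int[mu]_(x in `[0%R, 1%R]) (g x)%:E <= N%:E)%E.
  rewrite -NE; apply: ge0_subset_integral => //; first exact/measurable_EFinP.
  by move=> x _; rewrite lee_fin ltW.
(* Integrate [2 N <= g + N^2 / g], that is [(g - N)^2 >= 0], over [0, 1]; dividing by [N^2] then
   gives the claim. *)
have h2 : ((2 * N)%:E <= N%:E + (N ^+ 2)%:E * \int[mu]_(x in `[0%R, 1%R]) ((g x)^-1)%:E)%E.
  apply: le_trans (leeD h1 (lexx _)).
  rewrite -ge0_integralZl//; last 3 first.
  - by apply/measurable_EFinP; exact: measurable_funTS.
  - by move=> x _; rewrite lee_fin invr_ge0 ltW.
  - by rewrite lee_fin sqr_ge0.
  rewrite -ge0_integralD//; last 4 first.
  - by move=> x _; rewrite lee_fin ltW.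
  - by apply/measurable_EFinP; exact: measurable_funTS.
  - by move=> x _; rewrite -EFinM lee_fin mulr_ge0 ?sqr_ge0// invr_ge0 ltW.
  - by apply/measurable_EFinP; apply: measurable_funM => //; exact: measurable_funTS.
  rewrite (_ : (2 * N)%:E = \int[mu]_(x in `[0%R, 1%R]) (2 * N)%:E)%E; last first.
    by rewrite integral_cst//= lebesgue_measure_itv/= lte01 oppr0 adde0 mule1.
  apply: ge0_le_integral => //.
  - by move=> x _; rewrite lee_fin mulr_ge0// ltW.
  - apply/measurable_EFinP; apply: measurable_funTS.
    by apply: measurable_funD => //; exact: measurable_funM.
  - move=> x _; rewrite -EFinM -EFinD lee_fin.
    rewrite -subr_ge0 (_ : _ - _ = (g x - N) ^+ 2 / g x).
      by rewrite divr_ge0 ?sqr_ge0// ltW.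
    by field; rewrite gt_eqF.
move: h2 J0; case: (integral _ _ _) => [J| |]//=; rewrite ?leey//.
rewrite -EFinM -EFinD !lee_fin => h2 J0.
rewrite -(ler_pM2l N0) divff ?gt_eqF//; nra.
Qed.

End lebesgue_integrals.

(** * Measurable functionals of paths and exchange of integrals *)

Section path_functionals.
Context {R : realType}.
Local Notation mu := (@lebesgue_measure R).

Lemma continuous_eval (c : cpath R) : continuous (fun u => eval u c).
Proof. exact: svalP c. Qed.

Lemma measurable_eval_joint :
  measurable_fun setT (fun p : R * cpath R => eval p.1 p.2).
Proof. by apply: measurable_joint => [t|c]; [exact: measurable_eval|exact: continuous_eval]. Qed.

Lemma measurable_lebesgue_integral d (T : measurableType d) (f : R -> T -> R) :
  measurable_fun setT (fun p : R * T => f p.1 p.2) ->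
  measurable_fun setT (fun w => \int[mu]_u (f u w)%:E)%E.
Proof.
move=> mf; under eq_fun do rewrite integralE.
have mfe : measurable_fun setT (fun p : R * T => (f p.1 p.2)%:E) by exact/measurable_EFinP.
apply: emeasurable_funB.
- have := measurable_fun_fubini_tonelli_G (m1 := mu) _ (measurable_funepos mfe) (funepos_ge0 _).
  by apply: eq_measurable_fun => w _; apply: eq_integral => u _; rewrite /= !funeposE.
- have := measurable_fun_fubini_tonelli_G (m1 := mu) _ (measurable_funeneg mfe) (funeneg_ge0 _).
  by apply: eq_measurable_fun => w _; apply: eq_integral => u _; rewrite /= !funenegE.
Qed.

Lemma measurable_lebesgue_Rintegral d (T : measurableType d) (f : R -> T -> R) :
  measurable_fun setT (fun p : R * T => f p.1 p.2) ->
  measurable_fun setT (fun w => Rintegral mu setT (f ^~ w)).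
Proof.
by move=> /measurable_lebesgue_integral mf; exact: measurableT_comp (@fine_measurable _ setT _) mf.
Qed.

Lemma lebesgue_tonelli d (T : measurableType d) (P : probability T R) (f : R -> T -> R) :
  measurable_fun setT (fun p : R * T => f p.1 p.2) -> (forall u w, 0 <= f u w) ->
  (\int[P]_w \int[mu]_u (f u w)%:E = \int[mu]_u \int[P]_w (f u w)%:E)%E.
Proof.
move=> mf f0; apply/esym.
apply: (@fubini_tonelli _ _ _ _ _ mu P (fun p => (f p.1 p.2)%:E)) => [|p].
  exact/measurable_EFinP.
by rewrite lee_fin.
Qed.

Lemma measurable_mean d (T : measurableType d) (P : probability T R) (f : R -> T -> R) :
  measurable_fun setT (fun p : R * T => f p.1 p.2) -> (forall u w, 0 <= f u w) ->
  measurable_fun setT (fun u => \int[P]_w (f u w)%:E)%E.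
Proof.
move=> mf f0.
have mfe : measurable_fun setT (fun p : R * T => (f p.1 p.2)%:E) by exact/measurable_EFinP.
by apply: (measurable_fun_fubini_tonelli_F (m2 := P) _ mfe) => p; rewrite lee_fin.
Qed.

Lemma ae_lty d (T : measurableType d) (P : probability T R) (f : T -> \bar R) :
  measurable_fun setT f -> (forall w, 0 <= f w)%E -> (\int[P]_w f w < +oo)%E ->
  {ae P, forall w, (f w < +oo)%E}.
Proof.
move=> mf f0 foo; have : P.-integrable setT f.
  by apply/integrableP; split => //; under eq_integral do rewrite gee0_abs//.
move/(integrable_ae measurableT); apply: filterS => w /(_ Logic.I).
by rewrite ge0_fin_numE.
Qed.

Definition exp_integral (a : R) (c : cpath R) : R :=
  Rintegral mu setT (fun u => expR (a * eval u c)).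

Lemma measurable_exp_eval_joint a :
  measurable_fun setT (fun p : R * cpath R => expR (a * eval p.1 p.2)).
Proof.
apply: measurableT_comp => //; apply: measurable_funM => //.
exact: measurable_eval_joint.
Qed.

Lemma measurable_exp_integral a : measurable_fun setT (exp_integral a).
Proof.
exact: (measurable_lebesgue_Rintegral (f := fun u (c : cpath R) => expR (a * eval u c))
  (measurable_exp_eval_joint a)).
Qed.

Lemma exp_integral_ge0 a c : 0 <= exp_integral a c.
Proof. by apply: Rintegral_ge0 => u _; exact: expR_ge0. Qed.

Lemma measurable_exp_eval a (c : cpath R) : measurable_fun setT (fun u => expR (a * eval u c)).
Proof.
apply: measurableT_comp => //; apply: measurable_funM => //.
by apply: continuous_measurable_fun; exact: continuous_eval.
Qed.

(** How exponential integrals react to recentring a path at [t]. The identity extends to divergent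
    integrals, where both sides are 0. *)
Lemma ge0_fine_integral_shift_scale (f : R -> R) (t r : R) : 0 < r ->
  measurable_fun setT f -> (forall u, 0 <= f u) ->
  Rintegral mu setT (fun u => f (u + t) * r) = Rintegral mu setT f * r.
Proof.
move=> r0 mf f0; rewrite /Rintegral -fine_mul_gt0//; congr fine.
under eq_integral do rewrite EFinM.
rewrite ge0_integralZr//; last 3 first.
- apply/measurable_EFinP; apply: (measurableT_comp mf); exact: measurable_funD.
- by move=> u _; rewrite lee_fin.
- by rewrite lee_fin ltW.
rewrite (@ge0_integral_shift _ (fun u => (f u)%:E))//.
exact/measurable_EFinP.
Qed.

End path_functionals.

(** * Comparison of [Z_t] with the integral of its eighth root *)

Section integrability.
Context (R : realType) d (T : measurableType d) (P : probability T R).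
Variables (H : R) (W : R -> T -> R).
Hypotheses (H0 : 0 < H) (H1 : H <= 1).
Hypothesis fW : two_sided_fBm P H W.
Local Notation mu := (@lebesgue_measure R).
Local Notation logZ := (logZ H W).
Local Notation path_logZ := (path_logZ H0 fW).
Local Notation path_inclogZ := (path_inclogZ H0 fW).

Let k (t : R) : R := `|t| `^ (2 * H).

Lemma logZ0 w : logZ 0 w = 0.
Proof.
have [_ _ _ W0 _] := fW.
rewrite -[LHS]/(W 0 w - `|0| `^ (2 * H) / 2) W0 normr0 powR0 ?mul0r ?subrr//.
by rewrite mulf_neq0// gt_eqF.
Qed.

Lemma measurable_logZ_joint : measurable_fun setT (fun p : R * T => logZ p.1 p.2).
Proof.
by apply: measurable_joint => [t|w]; [exact: (measurable_logZ fW)|exact: (continuous_logZ H0 fW)].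
Qed.

Lemma measurable_Zt_joint : measurable_fun setT (fun p : R * T => Zt H W p.1 p.2).
Proof. by apply: measurableT_comp => //; exact: measurable_logZ_joint. Qed.

Lemma exp_logZ_diff a s u : has_mean P (fun w => expR (a * (logZ s w - logZ u w)))
  (expR (a ^+ 2 * k (s - u) / 2 - a * (k s - k u) / 2)).
Proof.
have := exp_lin_logZ H0 fW [:: (s, a); (u, - a)]; congr has_mean.
  apply/funext => w; congr expR; rewrite /eval_lin !big_cons big_nil/=.
  by rewrite /eval/= addr0; ring.
rewrite /fBm_var !big_cons !big_nil /= /k !subrr normr0 powR0; last first.
  by rewrite mulf_neq0// gt_eqF.
by congr expR; rewrite (distrC u s); field.
Qed.

(** Here [|s - u| <= 2 max(|s|, 1)], and [2^(2H) <= 4] because [H <= 1]. *)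
Lemma k_sub_le s u : 0 <= u <= 1 -> k (s - u) <= 4 * (k s + 1).
Proof.
move=> /andP[u0 u1]; have s0 := normr_ge0 s.
have H20 : 0 <= 2 * H by rewrite mulr_ge0// ltW.
pose x := Num.max `|s| 1.
have x0 : 0 <= x by rewrite le_max s0.
have kx : x `^ (2 * H) <= k s + 1.
  have [h|h] := lerP `|s| 1.
    by rewrite /x (max_idPr h) powR1 lerDr /k powR_ge0.
  by rewrite /x (max_idPl (ltW h)) /k lerDl.
apply: (@le_trans _ _ ((2 * x) `^ (2 * H))).
  apply: ge0_ler_powR => //; rewrite ?nnegrE ?mulr_ge0//.
  rewrite mulr_natl mulr2n (le_trans (ler_normB _ _))// (ger0_norm u0) lerD//.
    by rewrite le_max lexx.
  by rewrite le_max u1 orbT.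
rewrite powRM// ler_pM ?powR_ge0//.
apply: (@le_trans _ _ (2 `^ 2%:R)); last by rewrite powR_mulrn// expr2 -natrM.
by apply: ler_powR; [rewrite ler1n|rewrite -[leRHS]mulr1 ler_pM2l].
Qed.

(** By [k_sub_le] the quadratic term is at most [(k s + 1) / 32], half of the gain [k s / 16]; what
    remains besides [- k s / 32] is less than 1. *)
Lemma exp_logZ_diff_le s u : 0 <= u <= 1 ->
  expR (8^-1 ^+ 2 * k (s - u) / 2 - 8^-1 * (k s - k u) / 2) <=
  expR 1 * expR (- (32^-1 * k s)).
Proof.
move=> u01; rewrite -expRD ler_expR.
have := k_sub_le s u01; have : k u <= 1.
  have /andP[u0 u1] := u01; have -> : 1 = 1 `^ (2 * H) :> R by rewrite powR1.
  rewrite /k ger0_norm//.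
  by apply: ge0_ler_powR; rewrite ?nnegrE// mulr_ge0// ltW.
by rewrite expr2; lra.
Qed.

(* The exponent 1/8 makes the mean in [exp_logZ_diff] decay in [s]: the term [k (s - u)], which
   may be of order [4 * k s], enters with the factor [8^-1 ^+ 2]. *)
Definition root_integral (w : T) : R := exp_integral 8^-1 (path_logZ w).

Lemma root_integralE w :
  root_integral w = fine (\int[mu]_u (expR (8^-1 * logZ u w))%:E)%E.
Proof. by []. Qed.

Lemma measurable_root_integral : measurable_fun setT root_integral.
Proof.
apply: (measurableT_comp (measurable_exp_integral _)).
exact: measurable_path_logZ.
Qed.

Lemma root_integral_ge0 w : 0 <= root_integral w.
Proof. exact: exp_integral_ge0. Qed.

Lemma measurable_exp_logZ_joint a : measurable_fun setT (fun p : R * T => expR (a * logZ p.1 p.2)).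
Proof.
apply: measurableT_comp => //; apply: measurable_funM => //.
exact: measurable_logZ_joint.
Qed.

Let decay (t : R) : R := (1 + `|t|) * expR (- (32^-1 * k t)).

Lemma decay_ge0 t : 0 <= decay t.
Proof. by rewrite mulr_ge0 ?expR_ge0// addr_ge0. Qed.

Lemma measurable_decay : measurable_fun setT decay.
Proof.
apply: measurable_funM; first exact: measurable_funD.
apply: measurableT_comp => //; apply: measurableT_comp => //.
apply: measurable_funM => //.
exact: (measurableT_comp (measurable_powR _) (@normr_measurable R setT)).
Qed.

Lemma integral_decay c : (\int[mu]_t (c * decay t)%:E < +oo)%E.
Proof.
have dlty : (\int[mu]_t (decay t)%:E < +oo)%E.
  by apply: integral_decay_lty; [rewrite mulr_gt0|rewrite invr_gt0].
have di : mu.-integrable setT (EFin \o decay).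
  apply/integrableP; split; first by apply/measurable_EFinP; exact: measurable_decay.
  by under eq_integral do rewrite /= ger0_norm ?decay_ge0//.
exact: integrable_lty (integrableZl measurableT c di).
Qed.

(** Guarantees that [root_integral] is almost surely a genuine integral and not the default value 0
    of [fine]. The decay bound at [u = 0], where [logZ] vanishes, is integrable in time. *)
Lemma root_integral_lty : {ae P, forall w, (\int[mu]_u (expR (8^-1 * logZ u w))%:E < +oo)%E}.
Proof.
have mJ := measurable_exp_logZ_joint 8^-1.
have e0 u w : 0 <= expR (8^-1 * logZ u w) by exact: expR_ge0.
apply: ae_lty.
- exact: (measurable_lebesgue_integral mJ).
- by move=> w; apply: integral_ge0 => u _; rewrite lee_fin.
rewrite (lebesgue_tonelli P mJ e0).
apply: le_lt_trans (integral_decay (expR 1)).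
apply: ge0_le_integral => //.
- by move=> u _; apply: integral_ge0 => w _; rewrite lee_fin.
- exact: measurable_mean.
- by apply/measurable_EFinP; apply: measurable_funM => //; exact: measurable_decay.
move=> u _; have u01 : 0 <= (0 : R) <= 1 by rewrite lexx ler01.
have [_] := exp_logZ_diff 8^-1 u 0.
under eq_integral do rewrite logZ0 subr0.
move=> ->; rewrite lee_fin; apply: (le_trans (exp_logZ_diff_le u u01)).
by rewrite ler_pM2l ?expR_gt0// -[leLHS]mul1r ler_wpM2r ?expR_ge0// lerDl.
Qed.

(** Change of law for the functional [Phi]. On the recentred path, numerator and denominator both
    carry the factor [e^(- L_t / 8)], with [L] for [logZ], so only [1 / root_integral] is left to
    multiply [Z_t]. *)
Lemma mean_Zt_root_integral t :
  (\int[P]_w (Zt H W t w / root_integral w)%:E =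
   \int[P]_w (expR (8^-1 * logZ (- t) w) / root_integral w)%:E)%E.
Proof.
pose Phi (c : cpath R) := (expR (8^-1 * eval (- t) c) / exp_integral 8^-1 c)%:E.
have mPhi : measurable_fun setT Phi.
  apply/measurable_EFinP; apply: measurable_funM.
    apply: measurableT_comp => //; apply: measurable_funM => //.
    exact: measurable_eval.
  apply: measurable_funV_ge0; first exact: measurable_exp_integral.
  exact: exp_integral_ge0.
have Phi0 c : (0 <= Phi c)%E.
  by rewrite lee_fin mulr_ge0 ?expR_ge0// invr_ge0 exp_integral_ge0.
transitivity (\int[P]_w Phi (path_logZ w))%E => //.
rewrite -(change_of_law H0 fW t mPhi Phi0).
apply: eq_integral => w _; rewrite /Phi -EFinM; congr EFin.
have -> : exp_integral 8^-1 (path_inclogZ t w) =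
    root_integral w * expR (- (8^-1 * logZ t w)).
  rewrite -(ge0_fine_integral_shift_scale t) ?expR_gt0//.
  - by apply: eq_Rintegral => u _; rewrite -expRD -mulrBr.
  - exact: (measurable_exp_eval 8^-1 (path_logZ w)).
have -> : eval (- t) (path_inclogZ t w) = - logZ t w.
  by rewrite /eval/= /inclogZ addNr logZ0 sub0r.
rewrite mulrN; set e := expR (- _); have e0 : e != 0 by rewrite gt_eqF ?expR_gt0.
by rewrite invfM [_ * e^-1]mulrC mulrA divff// mul1r mulrC.
Qed.

Lemma mean_Zt_root_integral_le t :
  (\int[P]_w (Zt H W t w / root_integral w)%:E <= (expR 1 * expR (- (32^-1 * k t)))%:E)%E.
Proof.
rewrite mean_Zt_root_integral.
pose D : set R := `[0, 1]%classic; have mD : measurable D by exact: measurable_itv.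
have m1 : measurable_fun setT (\1_D : R -> R) by exact: measurable_indic mD.
(* [inv_integral_le] bounds the reciprocal of [root_integral] by an integral over [0, 1]. The
   indicator writes it over the whole line, so that Tonelli reduces the mean to that of exponentials
   of differences. *)
pose f u w : R := expR (8^-1 * (logZ (- t) w - logZ u w)) * \1_D u.
have f0 u w : 0 <= f u w by rewrite mulr_ge0 ?expR_ge0.
have mf : measurable_fun setT (fun p : R * T => f p.1 p.2).
  apply: measurable_funM.
    apply: measurableT_comp => //; apply: measurable_funM => //; apply: measurable_funB.
      exact: (measurableT_comp (measurable_logZ fW (- t)) measurable_snd).
    exact: measurable_logZ_joint.
  exact: (measurableT_comp m1 measurable_fst).
have ptw w : ((expR (8^-1 * logZ (- t) w) / root_integral w)%:E <=
    \int[mu]_u (f u w)%:E)%E.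
  rewrite EFinM; have gpos (u : R) : 0 < expR (8^-1 * logZ u w) by exact: expR_gt0.
  have mg : measurable_fun setT (fun u => expR (8^-1 * logZ u w)).
    exact: (measurable_exp_eval 8^-1 (path_logZ w)).
  have := inv_integral_le mg gpos.
  rewrite -root_integralE => h; apply: (le_trans (lee_wpmul2l _ h)).
    by rewrite lee_fin expR_ge0.
  rewrite -ge0_integralZl//; last first.
    apply/measurable_EFinP; apply: measurable_funTS.
    by apply: measurable_funV_ge0 => // u; exact: ltW.
  rewrite integral_mkcond le_eqVlt; apply/orP; left; apply/eqP.
  apply: eq_integral => u _; rewrite epatch_indic /f -!EFinM; congr (_ * _)%:E.
  by rewrite -expRN -expRD -mulrBr.
apply: (@le_trans _ _ (\int[P]_w \int[mu]_u (f u w)%:E)%E).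
  apply: ge0_le_integral => //.
  - by move=> w _; rewrite lee_fin mulr_ge0 ?expR_ge0// invr_ge0 root_integral_ge0.
  - apply/measurable_EFinP; apply: measurable_funM.
      apply: measurableT_comp => //; apply: measurable_funM => //.
      exact: (measurable_logZ fW).
    by apply: measurable_funV_ge0; [exact: measurable_root_integral|exact: root_integral_ge0].
  - exact: (measurable_lebesgue_integral mf).
rewrite (lebesgue_tonelli P mf f0).
pose B : R := expR 1 * expR (- (32^-1 * k t)).
have B0 : 0 <= B by rewrite mulr_ge0 ?expR_ge0.
apply: (@le_trans _ _ (\int[mu]_u (B * \1_D u)%:E)%E).
  apply: ge0_le_integral => //.
  - by move=> u _; apply: integral_ge0 => w _; rewrite lee_fin.
  - exact: measurable_mean.
  - by apply/measurable_EFinP; exact: measurable_funM.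
  move=> u _; rewrite /f indicE; have [uD|uD] := boolP (u \in D).
    under eq_integral do rewrite mulr1.
    have [_ ->] := exp_logZ_diff 8^-1 (- t) u.
    have u01 : 0 <= u <= 1 by move: uD; rewrite inE /D /= in_itv.
    rewrite lee_fin mulr1 (le_trans (exp_logZ_diff_le _ u01))//.
    by rewrite /B {1}/k normrN.
  by under eq_integral do rewrite mulr0; rewrite integral0 mulr0.
under eq_integral do rewrite EFinM.
rewrite ge0_integralZl//; last first.
  exact/measurable_EFinP.
have muD : mu D = 1%E by rewrite /D lebesgue_measure_itv/= lte01 oppr0 adde0.
by rewrite integral_indic// setIT [X in (_ * X <= _)%E](_ : _ = 1%E) ?mule1//; exact: muD.
Qed.

Lemma Zt_integrable_ae :
  {ae P, forall w, (\int[mu]_t ((1 + `|t|) * Zt H W t w)%:E < +oo)%E}.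
Proof.
pose f t w : R := (1 + `|t|) * (Zt H W t w / root_integral w).
have t0 (t : R) : 0 <= 1 + `|t| by rewrite addr_ge0.
have q0 t w : 0 <= Zt H W t w / root_integral w.
  by rewrite mulr_ge0 ?expR_ge0// invr_ge0 root_integral_ge0.
have f0 t w : 0 <= f t w by rewrite mulr_ge0.
have mabs : measurable_fun setT (fun t : R => 1 + `|t|) by exact: measurable_funD.
have mq : measurable_fun setT (fun p : R * T => Zt H W p.1 p.2 / root_integral p.2).
  apply: measurable_funM; first exact: measurable_Zt_joint.
  have mV : measurable_fun setT (fun w => (root_integral w)^-1).
    by apply: measurable_funV_ge0; [exact: measurable_root_integral|exact: root_integral_ge0].
  exact: (measurableT_comp mV measurable_snd).
have mf : measurable_fun setT (fun p : R * T => f p.1 p.2).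
  by apply: measurable_funM => //; exact: (measurableT_comp mabs measurable_fst).
have flty : {ae P, forall w, (\int[mu]_t (f t w)%:E < +oo)%E}.
  apply: ae_lty.
  - exact: (measurable_lebesgue_integral mf).
  - by move=> w; apply: integral_ge0 => u _; rewrite lee_fin.
  rewrite (lebesgue_tonelli P mf f0); apply: le_lt_trans (integral_decay (expR 1)).
  apply: ge0_le_integral => //.
  - by move=> u _; apply: integral_ge0 => w _; rewrite lee_fin.
  - exact: measurable_mean.
  - by apply/measurable_EFinP; apply: measurable_funM => //; exact: measurable_decay.
  move=> t _; under eq_integral do rewrite EFinM.
  have mqt : measurable_fun setT (fun w => (Zt H W t w / root_integral w)%:E).
    by apply/measurable_EFinP; exact: (measurableT_comp mq (pair1_measurable t)).
  have q0E w : setT w -> (0 <= (Zt H W t w / root_integral w)%:E)%E by rewrite lee_fin.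
  have t0E : (0 <= (1 + `|t|)%:E)%E by rewrite lee_fin.
  rewrite (ge0_integralZl P measurableT mqt q0E t0E).
  rewrite [decay t]/decay mulrCA EFinM lee_wpmul2l ?lee_fin//.
  exact: mean_Zt_root_integral_le.
move: flty root_integral_lty; apply: filterS2 => w fw rw.
have mZ : measurable_fun setT (fun t => expR (8^-1 * logZ t w)).
  exact: (measurable_exp_eval 8^-1 (path_logZ w)).
(* Finiteness matters here: a divergent integral would give 0, and multiplying back by
   [root_integral] would lose the information. *)
have r0 : 0 < root_integral w.
  rewrite root_integralE fine_gt0// rw andbT lebesgue_integral_gt0// => u.
  exact: expR_gt0.
have -> : (\int[mu]_t ((1 + `|t|) * Zt H W t w)%:E =
    \int[mu]_t ((root_integral w)%:E * (f t w)%:E))%E.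
  apply: eq_integral => t _; rewrite -EFinM; congr EFin.
  by rewrite /f; field; rewrite gt_eqF.
have mft : measurable_fun setT (fun t => (f t w)%:E).
  by apply/measurable_EFinP; exact: (measurableT_comp mf (pair2_measurable w)).
have f0E t : setT t -> (0 <= (f t w)%:E)%E by rewrite lee_fin.
have r0E : (0 <= (root_integral w)%:E)%E by rewrite lee_fin root_integral_ge0.
rewrite (ge0_integralZl mu measurableT mft f0E r0E).
by rewrite lte_mul_pinfty// lee_fin root_integral_ge0.
Qed.

End integrability.

(** * The shift identity *)

Section shift_identity.
Context (R : realType) d (T : measurableType d) (P : probability T R).
Variables (H : R) (W : R -> T -> R).
Hypotheses (H0 : 0 < H) (H1 : H <= 1).
Hypothesis fW : two_sided_fBm P H W.
Local Notation mu := (@lebesgue_measure R).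
Local Notation logZ := (logZ H W).
Local Notation path_logZ := (path_logZ H0 fW).
Local Notation path_inclogZ := (path_inclogZ H0 fW).

(** Applied to positive and negative parts separately; the factor [Zt] is nonnegative and passes
    through the maximum. *)
Lemma change_of_law_signed t (Phi : cpath R -> R) : measurable_fun setT Phi ->
  (\int[P]_w (Phi (path_inclogZ t w) * Zt H W t w)%:E = \int[P]_w (Phi (path_logZ w))%:E)%E.
Proof.
move=> mPhi; have mPhie : measurable_fun setT (EFin \o Phi) by exact/measurable_EFinP.
rewrite integralE [RHS]integralE; congr (_ - _)%E.
- transitivity (\int[P]_w (EFin \o Phi)^\+ (path_logZ w))%E; last first.
    by apply: eq_integral => w _; rewrite !funeposE.
  rewrite -(change_of_law H0 fW t (measurable_funepos mPhie) (funepos_ge0 _)).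
  apply: eq_integral => w _; rewrite !funeposE /= -!EFin_max -EFinM.
  by rewrite maxr_pMl ?mul0r// Zt_ge0.
- transitivity (\int[P]_w (EFin \o Phi)^\- (path_logZ w))%E; last first.
    by apply: eq_integral => w _; rewrite !funenegE.
  rewrite -(change_of_law H0 fW t (measurable_funeneg mPhie) (funeneg_ge0 _)).
  apply: eq_integral => w _; rewrite !funenegE /= -!EFin_max -EFinM.
  by rewrite maxr_pMl ?mul0r ?mulNr// Zt_ge0.
Qed.

(** This and [path_zeta] express [totalZ] and [zetaH] through the path alone, the form to which the
    change of law applies. *)
Definition path_total (c : cpath R) : R := Rintegral mu setT (fun u => expR (eval u c)).

Definition path_zeta (c : cpath R) : R :=
  Rintegral mu setT (fun u => u * (expR (eval u c) / path_total c)).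

Lemma path_totalE : path_total = exp_integral 1.
Proof. by apply/funext => c; apply: eq_Rintegral => u _; rewrite mul1r. Qed.

Lemma path_total_ge0 c : 0 <= path_total c.
Proof. by rewrite path_totalE exp_integral_ge0. Qed.

Lemma measurable_path_total : measurable_fun setT path_total.
Proof. by rewrite path_totalE; exact: measurable_exp_integral. Qed.

Lemma measurable_path_totalV : measurable_fun setT (fun c => (path_total c)^-1).
Proof. by apply: measurable_funV_ge0; [exact: measurable_path_total|exact: path_total_ge0]. Qed.

Lemma measurable_path_zeta : measurable_fun setT path_zeta.
Proof.
have m : measurable_fun setT (fun p : R * cpath R =>
    p.1 * (expR (eval p.1 p.2) / path_total p.2)).
  apply: measurable_funM; first exact: measurable_fst.
  apply: measurable_funM.
    by apply: measurableT_comp => //; exact: measurable_eval_joint.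
  exact: (measurableT_comp measurable_path_totalV measurable_snd).
exact: (measurable_lebesgue_Rintegral
  (f := fun u (c : cpath R) => u * (expR (eval u c) / path_total c)) m).
Qed.

Lemma path_total_logZ w : path_total (path_logZ w) = totalZ H W w.
Proof. by []. Qed.

Lemma path_zeta_logZ w : path_zeta (path_logZ w) = zetaH H W w.
Proof. by []. Qed.

Lemma measurable_zetaH : measurable_fun setT (zetaH H W).
Proof. exact: (measurableT_comp measurable_path_zeta (measurable_path_logZ H0 fW)). Qed.

Lemma measurable_totalZV : measurable_fun setT (fun w => (totalZ H W w)^-1).
Proof. exact: (measurableT_comp measurable_path_totalV (measurable_path_logZ H0 fW)). Qed.

Lemma measurable_qt_joint : measurable_fun setT (fun p : R * T => qt H W p.1 p.2).
Proof.
apply: measurable_funM; first exact: (measurable_Zt_joint H0 fW).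
exact: (measurableT_comp measurable_totalZV measurable_snd).
Qed.

Lemma measurable_Zt_path w : measurable_fun setT (fun t => Zt H W t w).
Proof. exact: (measurableT_comp (measurable_Zt_joint H0 fW) (pair2_measurable w)). Qed.

Lemma totalZ_ge0 w : 0 <= totalZ H W w.
Proof. exact: (path_total_ge0 (path_logZ w)). Qed.

Lemma qt_ge0 t w : 0 <= qt H W t w.
Proof. by rewrite mulr_ge0 ?expR_ge0// invr_ge0 totalZ_ge0. Qed.

(** [fine] maps infinities to 0, so a nonzero [totalZ] certifies that the integral is finite. *)
Lemma integral_Zt w : totalZ H W w != 0 ->
  (\int[mu]_t (Zt H W t w)%:E = (totalZ H W w)%:E)%E.
Proof.
by rewrite /totalZ /Rintegral; case: (integral _ _ _) => [r| |] //=; rewrite eqxx.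
Qed.

Lemma integral_qt w : totalZ H W w != 0 -> (\int[mu]_t (qt H W t w)%:E = 1)%E.
Proof.
move=> Z0; under eq_integral do rewrite EFinM.
have mZ : measurable_fun setT (fun t => (Zt H W t w)%:E).
  by apply/measurable_EFinP; exact: measurable_Zt_path.
have Z0E t : setT t -> (0 <= (Zt H W t w)%:E)%E by rewrite lee_fin Zt_ge0.
have V0 : (0 <= ((totalZ H W w)^-1)%:E)%E by rewrite lee_fin invr_ge0 totalZ_ge0.
by rewrite (ge0_integralZr mu measurableT mZ Z0E V0) integral_Zt// -EFinM divff.
Qed.

Lemma integral_qt_le1 w : (\int[mu]_t (qt H W t w)%:E <= 1)%E.
Proof.
(* On exceptional paths the inverse of 0 is 0, so [qt] vanishes and the bound holds for every
   [w]. *)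
have [Z0|Z0] := eqVneq (totalZ H W w) 0; last by rewrite integral_qt.
under eq_integral do rewrite /qt Z0 invr0 mulr0.
by rewrite integral0.
Qed.

Lemma measurable_qt_path w : measurable_fun setT (fun t => qt H W t w).
Proof. exact: (measurableT_comp measurable_qt_joint (pair2_measurable w)). Qed.

Lemma integral_qtN w : (\int[mu]_t (qt H W (- t) w)%:E = \int[mu]_t (qt H W t w)%:E)%E.
Proof.
apply: (ge0_integral_opp (f := fun t => (qt H W t w)%:E)) => [|t].
  by apply/measurable_EFinP; exact: measurable_qt_path.
by rewrite lee_fin qt_ge0.
Qed.

Section tame_path.
Variable w : T.
Hypothesis wlty : (\int[mu]_t ((1 + `|t|) * Zt H W t w)%:E < +oo)%E.

Let integrable_weight (h : R -> R) : measurable_fun setT h ->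
  (forall t, `|h t| <= 1 + `|t|) ->
  mu.-integrable setT (EFin \o (fun t => h t * Zt H W t w)).
Proof.
move=> mh hle; have mZ := measurable_Zt_path w.
apply/integrableP; split; first by apply/measurable_EFinP; exact: measurable_funM.
apply: le_lt_trans wlty; apply: ge0_le_integral => //.
- by apply/measurable_EFinP; apply: measurableT_comp => //; exact: measurable_funM.
- by apply/measurable_EFinP; apply: measurable_funM => //; exact: measurable_funD.
- move=> t _; rewrite /= lee_fin normrM (ger0_norm (Zt_ge0 _ _ _ _)).
  by rewrite ler_wpM2r ?Zt_ge0.
Qed.

Lemma integrable_Zt : mu.-integrable setT (EFin \o (fun t => Zt H W t w)).
Proof.
have i : mu.-integrable setT (EFin \o (fun t => 1 * Zt H W t w)).
  by apply: integrable_weight => // t; rewrite normr1 lerDl.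
by move: i; apply: eq_integrable => // t _; rewrite /= mul1r.
Qed.

Lemma totalZ_gt0 : 0 < totalZ H W w.
Proof.
rewrite fine_gt0// lebesgue_integral_gt0 /=; last 2 first.
- exact: measurable_Zt_path.
- by move=> t; exact: expR_gt0.
by have /integrable_lty -> := integrable_Zt.
Qed.

Lemma integrable_qt : mu.-integrable setT (EFin \o (fun t => qt H W t w)).
Proof.
have := integrableZr measurableT (totalZ H W w)^-1 integrable_Zt.
by apply: eq_integrable.
Qed.

Lemma integrable_id_qt : mu.-integrable setT (EFin \o (fun t => t * qt H W t w)).
Proof.
have i : mu.-integrable setT (EFin \o (fun t => t * Zt H W t w)).
  by apply: integrable_weight => // t; rewrite lerDr.
have := integrableZr measurableT (totalZ H W w)^-1 i.
by apply: eq_integrable => // t _; rewrite /= -EFinM /qt mulrA.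
Qed.

Lemma path_total_inclogZ t :
  path_total (path_inclogZ t w) = totalZ H W w * expR (- logZ t w).
Proof.
rewrite -(ge0_fine_integral_shift_scale t) ?expR_gt0//; last 2 first.
- exact: measurable_Zt_path.
- by move=> u; exact: Zt_ge0.
by apply: eq_Rintegral => u _; rewrite ZtE -expRD.
Qed.

(** Recentring scales [e^c] and its integral by the same factor, so the normalized density is [q]
    translated by [t]. Its barycentre moves by [- t] because [q] has total mass 1 and an integrable
    first moment. *)
Lemma path_zeta_inclogZ t : path_zeta (path_inclogZ t w) = zetaH H W w - t.
Proof.
have totN0 : totalZ H W w != 0 by rewrite gt_eqF// totalZ_gt0.
have eN0 : expR (- logZ t w) != 0 by rewrite gt_eqF// expR_gt0.
transitivity (Rintegral mu setT (fun u => (u + t - t) * qt H W (u + t) w)).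
  apply: eq_Rintegral => u _; rewrite path_total_inclogZ addrK; congr (_ * _).
  by rewrite /qt ZtE /eval/= /inclogZ expRD; field; rewrite totN0 eN0.
rewrite /Rintegral (@integral_shift _ (fun u => (u - t) * qt H W u w)); last first.
  by apply: measurable_funM; [exact: measurable_funB|exact: measurable_qt_path].
under eq_integral do rewrite mulrBl.
rewrite -/(Rintegral mu setT (fun u => u * qt H W u w - t * qt H W u w)).
rewrite RintegralB//; last 2 first.
- exact: integrable_id_qt.
- by have := integrableZl measurableT t integrable_qt; exact: eq_integrable.
rewrite RintegralZl//; last exact: integrable_qt.
by rewrite [X in _ * X](_ : _ = 1) ?mulr1// /Rintegral integral_qt.
Qed.

End tame_path.

Lemma mean_shift_qt (G : R -> R) t : measurable_fun setT G ->
  (\int[P]_w (G (zetaH H W w - t) * qt H W t w)%:E =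
   \int[P]_w (G (zetaH H W w) * qt H W (- t) w)%:E)%E.
Proof.
move=> mG.
pose Phi (c : cpath R) := G (path_zeta c) * (expR (eval (- t) c) / path_total c).
have mPhi : measurable_fun setT Phi.
  apply: measurable_funM; first exact: (measurableT_comp mG measurable_path_zeta).
  apply: measurable_funM; last exact: measurable_path_totalV.
  by apply: measurableT_comp => //; exact: measurable_eval.
have PhiE w : Phi (path_logZ w) = G (zetaH H W w) * qt H W (- t) w.
  by rewrite /Phi path_zeta_logZ path_total_logZ.
under [RHS]eq_integral do rewrite -PhiE.
rewrite -(change_of_law_signed t mPhi); apply: ae_eq_integral => //.
- apply/measurable_EFinP; apply: measurable_funM.
    apply: (measurableT_comp mG); apply: measurable_funB => //.
    exact: measurable_zetaH.
  exact: (measurableT_comp measurable_qt_joint (pair1_measurable t)).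
- apply/measurable_EFinP; apply: measurable_funM; last exact: (measurable_Zt fW).
  exact: (measurableT_comp mPhi (measurable_path_inclogZ H0 fW t)).
(* On almost every path the quotient in [Phi] becomes [e^(- L_t) / (totalZ e^(- L_t))], with [L] for
   [logZ]; multiplied by [Z_t] it is [q_t]. *)
have := Zt_integrable_ae H0 H1 fW; apply: filterS => w wlty _ /=; congr EFin.
have totN0 : totalZ H W w != 0 by rewrite gt_eqF// totalZ_gt0.
have eN0 : expR (- logZ t w) != 0 by rewrite gt_eqF// expR_gt0.
rewrite /Phi path_zeta_inclogZ// path_total_inclogZ -mulrA; congr (_ * _).
have -> : eval (- t) (path_inclogZ t w) = - logZ t w.
  by rewrite /eval/= /inclogZ addNr (logZ0 H0 fW) sub0r.
by rewrite /qt; field; rewrite totN0 eN0.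
Qed.

End shift_identity.

Theorem theorem2 (R : realType) (d : measure_display) (T : measurableType d)
    (P : probability T R) (H : R) (W : R -> T -> R) (G : R -> R) :
  0 < H <= 1 ->
  two_sided_fBm P H W ->
  measurable_fun setT G ->
  (exists M : R, forall x, `|G x| <= M) ->
  (\int[P]_w (G (zetaH H W w))%:E =
   \int[@lebesgue_measure R]_t
      \int[P]_w (G (zetaH H W w - t) * qt H W t w)%:E)%E.
Proof.
move=> /andP[H0 H1] fW mG [M GM].
pose f (p : R * T) := (G (zetaH H W p.2) * qt H W (- p.1) p.2)%:E.
have mGz : measurable_fun setT (fun w => G (zetaH H W w)).
  exact: (measurableT_comp mG (measurable_zetaH H0 fW)).
have mf : measurable_fun setT f.
  apply/measurable_EFinP; apply: measurable_funM.
    exact: (measurableT_comp mGz measurable_snd).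
  apply: (measurableT_comp (measurable_qt_joint H0 fW) (g := fun p : R * T => (- p.1, p.2))).
  by apply: measurable_fun_pair; [exact: measurableT_comp measurable_fst|exact: measurable_snd].
have mq w : measurable_fun setT (fun t : R => (qt H W (- t) w)%:E).
  apply/measurable_EFinP; apply: (measurableT_comp (measurable_qt_path H0 fW w)).
  exact: oppr_measurable.
have q0 w (t : R) : setT t -> (0 <= (qt H W (- t) w)%:E)%E by rewrite lee_fin (qt_ge0 H0 fW).
have M0 : 0 <= M by apply: le_trans (GM 0).
(* Absolute integrability for Fubini: [|f|] is at most [M] times [q_(-t)], whose integral in [t] is
   at most 1 on every path. *)
have fi : (@lebesgue_measure R \x P)%E.-integrable setT f.
  apply: (proj2 (integrable21ltyP (@lebesgue_measure R) P mf)).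
  apply: (@le_lt_trans _ _ (\int[P]_w M%:E)%E); last first.
    by rewrite (has_mean_cst P M).2 ltry.
  apply: ge0_le_integral => //.
  - by move=> w _; exact: integral_ge0.
  - exact: (measurable_fun_fubini_tonelli_G (m1 := @lebesgue_measure R) (fun p => `|f p|%E)
      (measurableT_comp (@abse_measurable R setT) mf) (fun p => abse_ge0 (f p))).
  move=> w _; apply: (@le_trans _ _ (\int[@lebesgue_measure R]_t (M%:E * (qt H W (- t) w)%:E))%E).
    apply: ge0_le_integral => //.
    - exact: (measurableT_comp (measurableT_comp (@abse_measurable R setT) mf)
        (pair2_measurable w)).
    - by apply: emeasurable_funM => //; exact: mq.
    - move=> t _; rewrite -EFinM lee_fin normrM (ger0_norm (qt_ge0 H0 fW _ _)).
      by rewrite ler_wpM2r ?(qt_ge0 H0 fW).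
  rewrite (ge0_integralZl (@lebesgue_measure R) measurableT (mq w) (q0 w))// (integral_qtN H0 fW).
  by rewrite -[leRHS]mule1 lee_wpmul2l ?lee_fin// (integral_qt_le1 H0 fW).
under [RHS]eq_integral do rewrite (mean_shift_qt H0 H1 fW _ mG).
rewrite -[RHS]/(\int[@lebesgue_measure R]_t \int[P]_w f (t, w))%E (Fubini fi).
apply: ae_eq_integral => //.
- exact/measurable_EFinP.
- have /measurable_EFinP mf' := mf.
  exact: (measurable_lebesgue_integral
    (f := fun t w => G (zetaH H W w) * qt H W (- t) w) mf').
(* Almost surely [totalZ] is positive, so the time integral of [q_(-t)] is exactly 1 and only
   [G (zetaH H W w)] remains. *)
have := Zt_integrable_ae H0 H1 fW; apply: filterS => w wlty _.
have tot0 : totalZ H W w != 0 by rewrite gt_eqF// (totalZ_gt0 H0 fW wlty).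
have qi : (@lebesgue_measure R).-integrable setT (fun t : R => (qt H W (- t) w)%:E).
  apply/integrableP; split; first exact: mq.
  under eq_integral do rewrite gee0_abs ?lee_fin ?(qt_ge0 H0 fW)//.
  by rewrite (integral_qtN H0 fW) (integral_qt H0 fW)// ltry.
rewrite /f /=; under eq_integral do rewrite EFinM.
by rewrite integralZl// (integral_qtN H0 fW) (integral_qt H0 fW)// mule1.
Qed.
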